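(* Let $(a_n)_{n=1}^\infty$ be a sequence of real numbers with $a_n>0$ for all $n$, and let $$T=\{0\}\cup\Bigl\{\sum_{n=1}^m a_n^2 : m\geq 1\Bigr\}.$$ Then the following are equivalent: (i) for every probability space $(\Omega,\mathcal{F},\mathbf{P})$ and every orthonormal sequence $(\varphi_n)_{n=1}^\infty$ on it, the series $\sum_{n=1}^\infty a_n\varphi_n$ converges almost everywhere; (ii) there exists a majorizing measure on $T$, i.e. a probability measure $m$ on $T$ such that $$\sup_{t\in T}\int_0^{\sqrt{D(T)}}\bigl(m(B(t,r^2))\bigr)^{-1/2}\,dr<\infty .$$
   Context: $D(T)=\sup_{s,t\in T}|s-t|$ (possibly $+\infty$) and $B(t,r)=\{s\in T: |s-t|\leq r\}$; the convention $0^{-1/2}=+\infty$ is used. An orthonormal sequence on $(\Omega,\mathcal{F},\mathbf{P})$ is a sequence of real random variables $\varphi_n:\Omega\to\mathbb{R}$ with $\mathbf{E}\varphi_n^2=1$ for all $n$ and $\mathbf{E}\varphi_n\varphi_m=0$ whenever $n\neq m$. *)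

(* Defs.v *)
From HB Require Import structures.
From mathcomp Require Import all_boot all_order all_algebra.
From mathcomp Require Import all_classical all_reals all_analysis.

Set Implicit Arguments.
Unset Strict Implicit.
Unset Printing Implicit Defensive.

Import Order.TTheory GRing.Theory Num.Theory.
Import numFieldNormedType.Exports.

Local Open Scope classical_set_scope.
Local Open Scope ring_scope.
Local Open Scope ereal_scope.

Definition orthonormal_sequence d (Omega : measurableType d) (R : realType)
    (P : probability Omega R) (phi : nat -> {RV P >-> R}) : Prop :=
  (forall n, 'E_P[fun w => (phi n w ^+ 2)%R] = 1) /\
  (forall n k, n <> k -> 'E_P[fun w => (phi n w * phi k w)%R] = 0).

(* Real sequences are indexed from 0, so [a n] stands for a_(n+1). *)
Definition partial_squares (R : realType) (a : R^nat) : set R :=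
  [set 0%R] `|`
  [set (\sum_(0 <= n < m) a n ^+ 2)%R | m in [set m | (1 <= m)%N]].

Definition diameter (R : realType) (T : set R) : \bar R :=
  ereal_sup [set (`|s - t|%R)%:E | s in T & t in T].

Definition cball_in (R : realType) (T : set R) (t r : R) : set R :=
  [set s | T s /\ (`|s - t| <= r)%R].

(* A probability measure on T is represented by its extension to a Borel
   probability measure on R giving mass 1 to T; this loses nothing when T is a
   Borel set, in particular when T is countable.
   In the integrand [0^-1] is [+oo] in the extended reals, and the domain of
   integration is [0, +oo[ when T is unbounded. *)
Definition majorizing_measure (R : realType) (T : set R)
    (m : probability (measurableTypeR R) R) : Prop :=
  m T = 1 /\
  ereal_sup
    [set \int[lebesgue_measure]_(r in [set r : R | 0%:E <= r%:E <= sqrte (diameter T)])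
           (sqrte (m (cball_in T t (r ^+ 2))))^-1 | t in T] < +oo.

(* Main.v *)
(* Put t_n = a_0^2 + ... + a_(n-1)^2, l = sup t_n, x_n = t_n / l, and let V be
   the maximum over probability measures m on T of the sum of
   2^-k * sqrt (m I) over all 4-adic cells I of level k. It obeys the recursion
   V(I) = 2^-k + sqrt (sum of V(J)^2 over the four children J of I), and both
   conditions are equivalent to V < oo.

   The recursion is that of the Rademacher-Menshov argument: the L2 norm of the
   oscillation of the series over I is at most 2 sqrt l V(I), and V tends to 0
   on the cells that contain a tail of T. So V < oo gives convergence.

   Conversely, when m splits almost evenly among the four children of I, the
   process may be given a drift of order 2^-k / sqrt (m I) by coefficients of
   the children's indicators that are centred both in space and in probability,
   so that they stay orthogonal to all other levels; at an uneven split the sum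
   of 2^-k sqrt (m I) decays geometrically instead. This gives finite orthonormal
   systems with maximal function of order V. If V = oo, copies of such systems
   on the digits of a mixed radix expansion form a divergent series.

   If m is a majorizing measure, apply the Cauchy-Schwarz inequality to V and to
   the masses w of the cells enlarged by their neighbours: V^2 <= S W, where W is
   the sum of 2^-k sqrt w, hence W <= 3 V, and S the supremum of the path sums
   of 2^-k / sqrt w, which the majorizing integral controls. In the other
   direction, distributing mass among children proportionally to V^2 makes
   V / sqrt m telescope along every path, which bounds the path sums by V. *)
Require Import Defs.
From HB Require Import structures.
From mathcomp Require Import all_boot all_order all_algebra.
From mathcomp Require Import all_classical all_reals all_analysis.
From mathcomp Require Import measurable_realfun zify ring lra.
Import Order.TTheory GRing.Theory Num.Theory.
Import numFieldNormedType.Exports.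
Local Open Scope classical_set_scope.
Local Open Scope ring_scope.
Set Implicit Arguments.
Unset Strict Implicit.
Unset Printing Implicit Defensive.

(** * The 4-adic tree *)

Section tree.
Variables (R : realType) (x : nat -> R).

(* The points x_n lie in [0, 1); cell k n is the index of the 4-adic interval
   of length 4^-k containing x_n. *)
Definition cell k n : nat := Num.truncn (4 ^+ k * x n).

Definition inhab k i : bool := `[< exists n, cell k n = i >].

(* treeV d 0 0 is the maximum over all probability measures m of the sum of
   2^-k * sqrt (m (cell)) over the cells of level k <= d, and treeV d k i is its
   analogue for the tree below the cell (k, i). *)
Fixpoint treeV d k i : R :=
  if inhab k i then
    2^-1 ^+ k + (if d is d'.+1
                 then Num.sqrt (\sum_(j < 4) treeV d' k.+1 (4 * i + j) ^+ 2)
                 else 0)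
  else 0.

Hypothesis x_ge0 : forall n, 0 <= x n.

Lemma cell_itv k n : (cell k n)%:R <= 4 ^+ k * x n < (cell k n).+1%:R.
Proof. by apply: truncn_itv; rewrite mulr_ge0 ?exprn_ge0. Qed.

Lemma cell_eqP k n i : cell k n = i <-> i%:R <= 4 ^+ k * x n < i.+1%:R.
Proof.
split=> [<-|]; first exact: cell_itv.
by move=> h; apply: truncn_def.
Qed.

Lemma cellS k n : cell k n = (cell k.+1 n %/ 4)%N.
Proof.
apply/cell_eqP; have /andP[h1 h2] := cell_itv k.+1 n.
have r4 : (cell k.+1 n %% 4 < 4)%N by rewrite ltn_mod.
move: r4 h1 h2; rewrite {2 3}(divn_eq (cell k.+1 n) 4).
move: (cell k.+1 n %/ 4)%N (cell k.+1 n %% 4)%N => q r r4.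
rewrite exprS -!natr1 natrD natrM.
have r3 : r%:R <= 3 :> R by rewrite ler_nat -ltnS.
have r0 : 0 <= r%:R :> R by [].
by rewrite -!mulrA; move: (4 ^+ k * x n) => p h1 h2; apply/andP; split; lra.
Qed.

Lemma cellS_in k n i (j : nat) : (j < 4)%N -> cell k.+1 n = (4 * i + j)%N -> cell k n = i.
Proof. by move=> j4 e; rewrite cellS e mulnC divnMDl// divn_small// addn0. Qed.

Lemma cell_child k n : exists2 j : 'I_4, cell k.+1 n = (4 * cell k n + j)%N & True.
Proof.
have r : (cell k.+1 n %% 4 < 4)%N by rewrite ltn_mod.
by exists (Ordinal r) => //=; rewrite (cellS k n) mulnC -divn_eq.
Qed.

Lemma inhabP k i : reflect (exists n, cell k n = i) (inhab k i).
Proof. exact: asboolP. Qed.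

Lemma inhab_cell k n : inhab k (cell k n).
Proof. by apply/inhabP; exists n. Qed.

Lemma inhab_parent k i (j : nat) : (j < 4)%N -> inhab k.+1 (4 * i + j) -> inhab k i.
Proof. by move=> j4 /inhabP[n /cellS_in e]; apply/inhabP; exists n; exact: e. Qed.

Lemma treeV_empty d k i : ~~ inhab k i -> treeV d k i = 0.
Proof. by case: d => [|d] /= /negbTE->. Qed.

Lemma treeVS d k i : inhab k i -> treeV d.+1 k i =
  2^-1 ^+ k + Num.sqrt (\sum_(j < 4) treeV d k.+1 (4 * i + j) ^+ 2).
Proof. by move=> /= ->. Qed.

Lemma treeV0 k i : inhab k i -> treeV 0 k i = 2^-1 ^+ k.
Proof. by move=> /= ->; rewrite addr0. Qed.

Lemma treeV_ge0 d k i : 0 <= treeV d k i.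
Proof.
case: d => [|d] /=; case: ifP => // _; rewrite addr_ge0 ?exprn_ge0 ?sqrtr_ge0//.
Qed.

Lemma treeV_ge d k i : inhab k i -> 2^-1 ^+ k <= treeV d k i.
Proof. by case: d => [|d] /= ->; rewrite lerDl ?sqrtr_ge0. Qed.

Lemma treeV_gt0 d k i : inhab k i -> 0 < treeV d k i.
Proof. by move=> /(treeV_ge d); apply: lt_le_trans; rewrite exprn_gt0 ?invr_gt0. Qed.

Lemma treeV_le d k i : treeV d k i <= treeV d.+1 k i.
Proof.
elim: d k i => [|d IH] k i.
  have [h|h] := boolP (inhab k i); first by rewrite treeV0 ?treeV_ge.
  by rewrite !treeV_empty.
have [h|h] := boolP (inhab k i); last by rewrite !treeV_empty.
rewrite treeVS// [leRHS]treeVS// lerD2l ler_sqrt ?sumr_ge0// => [|j _]; last exact: sqr_ge0.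
by apply: ler_sum => j _; rewrite ler_sqr ?nnegrE ?treeV_ge0 ?IH.
Qed.

Lemma treeV_nd k i : nondecreasing_seq (fun d => treeV d k i).
Proof. by apply/nondecreasing_seqP => d; exact: treeV_le. Qed.

Lemma treeV_child d k i (j : 'I_4) : treeV d k.+1 (4 * i + j) <= treeV d.+1 k i.
Proof.
have [h|h] := boolP (inhab k.+1 (4 * i + j)); last by rewrite treeV_empty ?treeV_ge0.
rewrite treeVS; last exact: inhab_parent (ltn_ord j) h.
apply: (@le_trans _ _ (Num.sqrt (treeV d k.+1 (4 * i + j) ^+ 2))).
  by rewrite sqrtr_sqr ger0_norm ?treeV_ge0.
apply: (@le_trans _ _ (Num.sqrt (\sum_(j < 4) treeV d k.+1 (4 * i + j) ^+ 2))).
  have s0 (P : pred 'I_4) : 0 <= \sum_(j < 4 | P j) treeV d k.+1 (4 * i + j) ^+ 2.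
    by rewrite sumr_ge0// => l _; exact: sqr_ge0.
  by rewrite ler_sqrt// (bigD1 j)//= lerDl s0.
by rewrite lerDr exprn_ge0 ?invr_ge0.
Qed.

Section bounded.
Variable B : R.
Hypothesis x_lt1 : forall n, x n < 1.
Hypothesis VB : forall d, treeV d 0 0 <= B.

Lemma cell0 n : cell 0 n = 0%N.
Proof. by apply/cell_eqP; rewrite expr0 mul1r x_ge0/= x_lt1. Qed.

(** Going up one level raises the depth by one, so the induction on [k] generalises [d]; this is
    harmless because [VB] is uniform in the depth. *)
Lemma treeV_bounded d k i : treeV d k i <= B.
Proof.
have [h|h] := boolP (inhab k i); last first.
  by rewrite treeV_empty//; apply: le_trans (VB 0); exact: treeV_ge0.
elim: k d i h => [|k IH] d i /inhabP[n ni].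
  by move: ni; rewrite cell0 => <-.
have [j e _] := cell_child k n.
rewrite -ni e; apply: le_trans (treeV_child _ _ _ _) _.
exact/IH/inhab_cell.
Qed.

(** The value at infinite depth: [treeV] is nondecreasing in [d] and bounded by [B]. *)
Definition Vlim k i : R := limn (fun d => treeV d k i).

Lemma treeV_cvg k i : treeV d k i @[d --> \oo] --> Vlim k i.
Proof.
apply: nondecreasing_is_cvgn; first exact: treeV_nd.
by exists B => _ [d _ <-]; exact: treeV_bounded.
Qed.

Lemma treeV_le_lim d k i : treeV d k i <= Vlim k i.
Proof.
apply: (nondecreasing_cvgn_le (@treeV_nd k i)).
by apply/cvg_ex; exists (Vlim k i); exact: treeV_cvg.
Qed.

Lemma Vlim_le k i c : (forall d, treeV d k i <= c) -> Vlim k i <= c.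
Proof.
by move=> h; apply: limr_le; [apply/cvg_ex; exists (Vlim k i); exact: treeV_cvg|exact: nearW].
Qed.

Lemma Vlim_empty k i : ~~ inhab k i -> Vlim k i = 0.
Proof.
move=> h; apply/le_anti/andP; split; last by rewrite -(treeV_empty 0 h) treeV_le_lim.
by apply: Vlim_le => d; rewrite treeV_empty.
Qed.

Lemma Vlim_ge0 k i : 0 <= Vlim k i.
Proof. by apply: le_trans (treeV_le_lim 0 k i); exact: treeV_ge0. Qed.

Lemma Vlim_gt0 k i : inhab k i -> 0 < Vlim k i.
Proof. by move=> h; apply: lt_le_trans (treeV_le_lim 0 k i); exact: treeV_gt0. Qed.

(** The recursion passes to the limit in the depth by continuity of the square root. *)
Lemma VlimS k i : inhab k i ->
  2^-1 ^+ k + Num.sqrt (\sum_(j < 4) Vlim k.+1 (4 * i + j) ^+ 2) <= Vlim k i.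
Proof.
move=> h.
pose s d : R := \sum_(j < 4) treeV d k.+1 (4 * i + j) ^+ 2.
have cs : s d @[d --> \oo] --> \sum_(j < 4) Vlim k.+1 (4 * i + j) ^+ 2.
  have c2 (j : nat) : treeV d k.+1 (4 * i + j) ^+ 2 @[d --> \oo] --> Vlim k.+1 (4 * i + j) ^+ 2.
    by rewrite expr2; under eq_fun do rewrite expr2; apply: cvgM; exact: treeV_cvg.
  by apply: cvg_big => [|j _]; [exact: add_continuous|exact: c2].
have cr : 2^-1 ^+ k + Num.sqrt (s d) @[d --> \oo] -->
    2^-1 ^+ k + Num.sqrt (\sum_(j < 4) Vlim k.+1 (4 * i + j) ^+ 2).
  by apply: cvgD; [exact: cvg_cst|apply: continuous_cvg cs; exact: sqrt_continuous].
rewrite -(cvg_lim _ cr)//; apply: limr_le; first by apply/cvg_ex; eexists; exact: cr.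
by apply: nearW => d; rewrite -treeVS ?treeV_le_lim.
Qed.

End bounded.
End tree.

(** * Finite systems with a large maximal function *)

Section sum_of_squares.
Variable R : realType.
Implicit Types (N : nat) (u v lam : nat -> R) (q : (nat -> R) -> R).

Definition lin N v lam : R := \sum_(n < N) lam n * v n.

(** A positivity certificate for the quadratic form [q] with explicit vectors; these are later
    adjoined to a frame to complete its Gram form. *)
Definition sos N q := exists s : seq (nat -> R),
  forall lam, q lam = \sum_(v <- s) lin N v lam ^+ 2.

Lemma linD N u v lam : lin N (fun n => u n + v n) lam = lin N u lam + lin N v lam.
Proof. by rewrite /lin -big_split/=; apply: eq_bigr => n _; rewrite mulrDr. Qed.

Lemma linZ N c v lam : lin N (fun n => c * v n) lam = c * lin N v lam.
Proof. by rewrite /lin mulr_sumr; apply: eq_bigr => n _; rewrite mulrCA. Qed.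

Lemma lin_sum N (I : finType) (F : I -> nat -> R) lam :
  lin N (fun n => \sum_i F i n) lam = \sum_i lin N (F i) lam.
Proof.
rewrite /lin exchange_big/=; apply: eq_bigr => n _.
by rewrite mulr_sumr.
Qed.

Lemma eq_sos N q q' : (forall lam, q lam = q' lam) -> sos N q -> sos N q'.
Proof. by move=> e [s h]; exists s => lam; rewrite -e. Qed.

Lemma sos0 N : sos N (fun=> 0).
Proof. by exists [::] => lam; rewrite big_nil. Qed.

Lemma sosD N q q' : sos N q -> sos N q' -> sos N (fun lam => q lam + q' lam).
Proof. by move=> [s h] [s' h']; exists (s ++ s') => lam; rewrite big_cat/= h h'. Qed.

Lemma sosZ N c q : 0 <= c -> sos N q -> sos N (fun lam => c * q lam).
Proof.
move=> c0 [s h]; exists [seq (fun n => Num.sqrt c * v n) | v <- s] => lam.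
rewrite big_map h mulr_sumr; apply: eq_bigr => v _.
by rewrite linZ exprMn sqr_sqrtr.
Qed.

Lemma sos_lin N v : sos N (fun lam => lin N v lam ^+ 2).
Proof. by exists [:: v] => lam; rewrite big_seq1. Qed.

Lemma sos_sum N (I : Type) (r : seq I) (F : I -> (nat -> R) -> R) :
  (forall i, sos N (F i)) -> sos N (fun lam => \sum_(i <- r) F i lam).
Proof.
move=> h; elim: r => [|i r IH].
  by apply: eq_sos (@sos0 N) => lam; rewrite big_nil.
by apply: eq_sos (sosD (h i) IH) => lam; rewrite big_cons.
Qed.

Lemma sos_coef N n : (n < N)%N -> sos N (fun lam => lam n ^+ 2).
Proof.
move=> nN; apply: eq_sos (@sos_lin N (fun m => (m == n)%:R)) => lam.
rewrite /lin (bigD1 (Ordinal nN))//= eqxx mulr1 big1 ?addr0// => m.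
by rewrite -val_eqE/= => /negbTE->; rewrite mulr0.
Qed.

Lemma sos_coefB N n m : (n < N)%N -> (m < N)%N -> sos N (fun lam => (lam n - lam m) ^+ 2).
Proof.
move=> nN mN; apply: eq_sos (@sos_lin N (fun l => (l == n)%:R + -1 * (l == m)%:R)) => lam.
have e p : (p < N)%N -> lin N (fun l => (l == p)%:R) lam = lam p.
  move=> pN; rewrite /lin (bigD1 (Ordinal pN))//= eqxx mulr1 big1 ?addr0// => l.
  by rewrite -val_eqE/= => /negbTE->; rewrite mulr0.
by rewrite linD linZ !e// mulN1r.
Qed.

(** With [s] the sum of the [w n], Lagrange's identity turns the form into [(2 * W)^-1] times the
    sum of [w n * w m * (lam n - lam m) ^+ 2], plus a diagonal form with the nonnegative factor
    [(W - s) / W]. *)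
Lemma sos_variance N (w : nat -> R) W : 0 < W -> (forall n, 0 <= w n) ->
  \sum_(n < N) w n <= W ->
  sos N (fun lam => \sum_(n < N) lam n ^+ 2 * w n - W^-1 * lin N w lam ^+ 2).
Proof.
move=> W0 w0 wW.
have h1 : sos N (fun lam => \sum_(n < N) \sum_(m < N)
    (2 * W)^-1 * w n * w m * (lam n - lam m) ^+ 2).
  apply: sos_sum => n; apply: sos_sum => m; apply: sosZ; last exact: sos_coefB.
  by rewrite !mulr_ge0// invr_ge0 mulr_ge0// ltW.
have h2 : sos N (fun lam => \sum_(n < N) (W - \sum_(n < N) w n) / W * w n * lam n ^+ 2).
  apply: sos_sum => n; apply: sosZ; last exact: sos_coef.
  by rewrite mulr_ge0// mulr_ge0 ?subr_ge0// invr_ge0 ltW.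
apply: eq_sos (sosD h1 h2) => lam.
set s := \sum_(n < N) w n; set S := \sum_(n < N) lam n ^+ 2 * w n.
have -> : \sum_(n < N) (W - s) / W * w n * lam n ^+ 2 = (W - s) / W * S.
  by rewrite mulr_sumr; apply: eq_bigr => n _; rewrite -mulrA (mulrC (w n)).
have -> : \sum_(n < N) \sum_(m < N) (2 * W)^-1 * w n * w m * (lam n - lam m) ^+ 2 =
    (2 * W)^-1 * (2 * (s * S) - 2 * lin N w lam ^+ 2).
  have e : 2 * (s * S) - 2 * lin N w lam ^+ 2 =
    \sum_(n < N) \sum_(m < N) w n * w m * (lam n - lam m) ^+ 2.
    have -> : 2 * (s * S) = s * S + S * s by ring.
    rewrite expr2 /s /S /lin !big_distrlr/= mulr_sumr -sumrN -!big_split/=.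
    apply: eq_bigr => n _; rewrite mulr_sumr -sumrN -!big_split/=.
    by apply: eq_bigr => m _; ring.
  rewrite e mulr_sumr; apply: eq_bigr => n _; rewrite !mulr_sumr.
  by apply: eq_bigr => m _; ring.
by field; rewrite lt0r_neq0.
Qed.

End sum_of_squares.

(** * Configurations on the cells of the tree and their merging *)

Section configurations.
Variables (R : realType) (x : nat -> R).
Hypothesis x_ge0 : forall n, 0 <= x n.
Hypothesis x_nd : forall n, x n <= x n.+1.
Hypothesis x0 : x 0%N = 0.

Definition qpt k (i : nat) : R := i%:R / 4 ^+ k.

(** The length of the part of the 4-adic interval that lies to the left of [y]. *)
Definition cov k i (y : R) : R := Num.min y (qpt k i.+1) - Num.min y (qpt k i).

(** The length of the intersection of the 4-adic interval with [[x n, x n.+1]]. *)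
Definition overlap k i n : R := cov k i (x n.+1) - cov k i (x n).

Lemma qptS k i : qpt k.+1 (4 * i + 0) = qpt k i.
Proof. by rewrite /qpt addn0 natrM exprS invfM mulrACA divff ?mul1r. Qed.

Lemma qpt_child k i : qpt k.+1 (4 * i).+4 = qpt k i.+1.
Proof. by rewrite -(qptS k i.+1) addn0 mulnS addnC addn4. Qed.

Lemma cov_child k i y : cov k i y = \sum_(j < 4) cov k.+1 (4 * i + j) y.
Proof.
rewrite !big_ord_recl big_ord0 /= /bump/= /cov -qpt_child -(qptS k i).
by rewrite ?addn0 !addnS !addn0; ring.
Qed.

Lemma overlap_child k i n : overlap k i n = \sum_(j < 4) overlap k.+1 (4 * i + j) n.
Proof. by rewrite /overlap !cov_child -sumrB. Qed.

Lemma qptD k i : qpt k i.+1 = qpt k i + (4 ^+ k)^-1.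
Proof. by rewrite /qpt -natr1 mulrDl mul1r. Qed.

Lemma cov_nd k i y z : y <= z -> cov k i y <= cov k i z.
Proof.
move=> yz; rewrite /cov.
have : qpt k i <= qpt k i.+1 by rewrite qptD lerDl invr_ge0 exprn_ge0.
move: (qpt k i) (qpt k i.+1) => a b ab.
by rewrite /Num.min; case: ltP => ?; case: ltP => ?; case: ltP => ?; case: ltP => ?; lra.
Qed.

Lemma overlap_ge0 k i n : 0 <= overlap k i n.
Proof. by rewrite subr_ge0; exact: cov_nd. Qed.

Lemma qpt_ge0 k i : 0 <= qpt k i.
Proof. by rewrite divr_ge0// exprn_ge0. Qed.

Lemma cov0 k i : cov k i 0 = 0.
Proof. by rewrite /cov !min_l ?qpt_ge0// subr0. Qed.

Lemma cov_le k i y : cov k i y <= (4 ^+ k)^-1.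
Proof.
rewrite /cov qptD; have : 0 <= (4 ^+ k)^-1 :> R by rewrite invr_ge0 exprn_ge0.
by move: (qpt k i) ((4 ^+ k)^-1) => a b ab; rewrite /Num.min; case: ltP => ?; case: ltP => ?; lra.
Qed.

Lemma sum_overlap k i N : \sum_(n < N) overlap k i n = cov k i (x N).
Proof.
rewrite -(big_mkord xpredT (overlap k i)) /overlap telescope_sumr// x0 cov0 subr0//.
Qed.

Lemma qpt_le k i n : (i <= cell x k n)%N -> qpt k i <= x n.
Proof.
move=> h; rewrite /qpt ler_pdivrMr ?exprn_gt0// mulrC.
have /andP[+ _] := cell_itv x_ge0 k n; apply: le_trans.
by rewrite ler_nat.
Qed.

Lemma qpt_ge k i n : (cell x k n < i)%N -> x n <= qpt k i.
Proof.
move=> h; rewrite /qpt ler_pdivlMr ?exprn_gt0// mulrC.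
have /andP[_ /ltW] := cell_itv x_ge0 k n; move=> /le_trans; apply.
by rewrite ler_nat.
Qed.

Lemma cov_right k i n : (i < cell x k n)%N -> cov k i (x n) = (4 ^+ k)^-1.
Proof.
move=> h; rewrite /cov !min_r ?qpt_le//; last exact: ltnW.
by rewrite qptD addrC addKr.
Qed.

Lemma cov_left k i n : (cell x k n < i)%N -> cov k i (x n) = 0.
Proof.
move=> h; rewrite /cov !min_l ?subrr//; first exact: qpt_ge.
by apply: qpt_ge => //; rewrite ltnS ltnW.
Qed.

(* An element (nu, g, tau) of a configuration stands for an outcome of weight
   nu on which the process has increments g and is evaluated at x_tau. *)
Definition outcome : Type := (R * (nat -> R) * nat)%type.

(** Let f be the step function equal to [lam n] between [x n] and [x n.+1] for n < N, and 0
    elsewhere. This is the squared L2 distance on the cell from f to the constants: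
    [lin N (overlap k i) lam] is the integral of f over the cell, and [4 ^+ k] the inverse length of
    the cell. *)
Definition slack N k i (lam : nat -> R) : R := \sum_(n < N) lam n ^+ 2 * overlap k i n -
  (2 ^+ k * lin N (overlap k i) lam) ^+ 2.

(** The third clause centres the increments in probability. The last one bounds their Gram form by
    the part of the coefficients orthogonal to constants on the cell, which leaves the mean over the
    cell to the coarser levels. *)
Definition config k i (c : seq outcome) :=
  [/\ forall w, w \in c -> 0 <= w.1.1 /\ cell x k w.2 = i,
      \sum_(w <- c) w.1.1 = (inhab x k i)%:R,
      forall n, \sum_(w <- c) w.1.1 * w.1.2 n = 0 &
      forall N, sos N (fun lam => slack N k i lam -
                                  \sum_(w <- c) w.1.1 * lin N w.1.2 lam ^+ 2)].

(** The mean of the process at an index that depends on the outcome; it can be positive although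
    every increment has mean zero. *)
Definition gain (c : seq outcome) : R :=
  \sum_(w <- c) w.1.1 * \sum_(n < w.2) w.1.2 n.

Lemma exp4 k : 4 ^+ k = 2 ^+ k ^+ 2 :> R.
Proof. by rewrite exprAC; congr (_ ^+ _); ring. Qed.

Lemma sos_slack N k i : sos N (slack N k i).
Proof.
have w0 : 0 < (4 ^+ k)^-1 :> R by rewrite invr_gt0 exprn_gt0.
have ws : \sum_(n < N) overlap k i n <= (4 ^+ k)^-1 by rewrite sum_overlap cov_le.
apply: eq_sos (sos_variance w0 (overlap_ge0 k i) ws) => lam.
by rewrite /slack invrK exp4 exprMn.
Qed.

Lemma config_nil k i : ~~ inhab x k i -> config k i [::].
Proof.
move=> h; rewrite /config big_nil (negbTE h); split=> // [n|N].
  by rewrite big_nil.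
by apply: eq_sos (sos_slack N k i) => lam; rewrite big_nil subr0.
Qed.

Lemma config_leaf k i : inhab x k i -> exists2 c, config k i c & gain c = 0.
Proof.
move=> ki; have /inhabP[n ni] := ki; exists [:: (1, fun=> 0, n)]; last first.
  by rewrite /gain big_seq1/= big1 ?mulr0.
rewrite /config big_seq1 ki; split=> // [w|n'|N]; first by rewrite inE => /eqP->.
  by rewrite big_seq1 mulr0.
apply: eq_sos (sos_slack N k i) => lam; rewrite big_seq1/= mul1r.
by rewrite /lin big1 ?expr0n ?subr0// => l _; rewrite mulr0.
Qed.

Section merge.
Variables (k i : nat) (c : 'I_4 -> seq outcome) (q : 'I_4 -> R) (h : 'I_4 -> nat -> R).
Hypothesis cc : forall j : 'I_4, config k.+1 (4 * i + j) (c j).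
Hypothesis q0 : forall j, 0 <= q j.
Hypothesis q_inhab : forall j : 'I_4, q j != 0 -> inhab x k.+1 (4 * i + j).
Hypothesis q_nil : forall j, q j = 0 -> c j = [::].
Hypothesis q1 : \sum_j q j ^+ 2 = 1.
Hypothesis h_mean : forall n, \sum_j q j ^+ 2 * h j n = 0.
Hypothesis h_sos : forall N, sos N (fun lam =>
  \sum_(j < 4) (2 ^+ k.+1 * lin N (overlap k.+1 (4 * i + j)) lam) ^+ 2 -
  (2 ^+ k * lin N (overlap k i) lam) ^+ 2 - \sum_j q j ^+ 2 * lin N (h j) lam ^+ 2).

(** Child j is chosen with probability [q j ^+ 2]. Dividing its increments by [q j] preserves its
    share of the Gram form and multiplies its gain by [q j]; [h j] is a drift common to all outcomes
    of the child. *)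
Definition merge : seq outcome :=
  [seq (q j ^+ 2 * w.1.1, fun n => (q j)^-1 * w.1.2 n + h j n, w.2)
     | j <- enum 'I_4, w <- c j].

Lemma big_merge (F : outcome -> R) : \sum_(w <- merge) F w =
  \sum_j \sum_(w <- c j) F (q j ^+ 2 * w.1.1, fun n => (q j)^-1 * w.1.2 n + h j n, w.2).
Proof. by rewrite big_allpairs_dep big_enum. Qed.

Lemma sum_weight j : q j ^+ 2 * \sum_(w <- c j) w.1.1 = q j ^+ 2.
Proof.
have [->|/q_inhab h0] := eqVneq (q j) 0; first by rewrite expr0n mul0r.
by have [_ -> _ _] := cc j; rewrite h0 mulr1.
Qed.

Lemma qqV j : q j ^+ 2 * (q j)^-1 = q j.
Proof.
have [->|h0] := eqVneq (q j) 0; first by rewrite invr0 mulr0.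
by rewrite expr2 mulfK.
Qed.

(** Since the increments of each child are centred, they have no cross terms with the drift [h j].
    Both the Gram form and the slack thus split into the parts inside the children, compared by
    [cc], and a part between the children, compared by [h_sos]. *)
Lemma config_merge : inhab x k i -> config k i merge.
Proof.
move=> ki; split.
- move=> w /allpairsPdep[j [v [_ vc ->]]] /=.
  have [cw _ _ _] := cc j; have [v0 vi] := cw _ vc; split; first by rewrite mulr_ge0 ?sqr_ge0.
  exact: (cellS_in x_ge0 (ltn_ord j) vi).
- rewrite big_merge/= ki; apply: etrans q1; apply: eq_bigr => j _.
  by rewrite -mulr_sumr sum_weight.
- move=> n; rewrite big_merge/=; apply: etrans (h_mean n); apply: eq_bigr => j _.
  under eq_bigr do rewrite mulrDr mulrACA.
  rewrite big_split/= -mulr_sumr; have [_ _ -> _] := cc j; rewrite mulr0 add0r.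
  by rewrite -mulr_suml -mulr_sumr sum_weight.
- move=> N; have sc : sos N (fun lam : nat -> R => \sum_(j < 4) (slack N k.+1 (4 * i + j) lam -
      \sum_(w <- c j) w.1.1 * lin N w.1.2 lam ^+ 2)).
    by apply: sos_sum => j; have [_ _ _] := cc j; apply.
  apply: eq_sos (sosD sc (h_sos N)) => lam.
  have e1 : \sum_(w <- merge) w.1.1 * lin N w.1.2 lam ^+ 2 =
    \sum_j (\sum_(w <- c j) w.1.1 * lin N w.1.2 lam ^+ 2 + q j ^+ 2 * lin N (h j) lam ^+ 2).
    rewrite big_merge/=; apply: eq_bigr => j _.
    transitivity (\sum_(w <- c j) ((q j ^+ 2 * (q j)^-1 ^+ 2) * (w.1.1 * lin N w.1.2 lam ^+ 2) +
      ((2 * q j ^+ 2 * (q j)^-1 * lin N (h j) lam) * (w.1.1 * lin N w.1.2 lam) +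
      (lin N (h j) lam ^+ 2) * (q j ^+ 2 * w.1.1)))).
      by apply: eq_bigr => w _; rewrite linD linZ; ring.
    rewrite !big_split/= -!mulr_sumr sum_weight.
    have -> : \sum_(w <- c j) w.1.1 * lin N w.1.2 lam = 0.
      under eq_bigr do rewrite /lin mulr_sumr; rewrite exchange_big/= big1// => n _.
      under eq_bigr do rewrite mulrCA; rewrite -mulr_sumr.
      by have [_ _ -> _] := cc j; rewrite mulr0.
    rewrite mulr0 add0r [X in _ + X]mulrC; congr (_ + _).
    (* A child with [q j = 0] has the empty configuration, so the default [0^-1 = 0] does no
       harm. *)
    have [/q_nil->|qn0] := eqVneq (q j) 0; first by rewrite !big_nil mulr0.
    by rewrite -exprMn divff// expr1n mul1r.
  rewrite e1 [in RHS]big_split/= !sumrB.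
  have -> : \sum_(j < 4) \sum_(n < N) lam n ^+ 2 * overlap k.+1 (4 * i + j) n =
      \sum_(n < N) lam n ^+ 2 * overlap k i n.
    rewrite exchange_big/=; apply: eq_bigr => n _.
    by rewrite -mulr_sumr -overlap_child.
  by rewrite /slack; ring.
Qed.

Lemma gain_merge : gain merge =
  \sum_j (q j * gain (c j) + q j ^+ 2 * \sum_(w <- c j) w.1.1 * \sum_(n < w.2) h j n).
Proof.
rewrite /gain big_merge/=; apply: eq_bigr => j _; rewrite !mulr_sumr -big_split/=.
apply: eq_bigr => w _; rewrite big_split/= -mulr_sumr -[X in _ = X * _ + _]qqV; ring.
Qed.

End merge.
End configurations.

(** * Bounding the tree functional by the gain of a configuration *)

Section lower_bound.
Variables (R : realType) (x : nat -> R).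
Hypothesis x_ge0 : forall n, 0 <= x n.
Hypothesis x_nd : forall n, x n <= x n.+1.
Hypothesis x0 : x 0%N = 0.

Let o0 : 'I_4 := @Ordinal 4 0 isT.
Let o1 : 'I_4 := @Ordinal 4 1 isT.
Let o2 : 'I_4 := @Ordinal 4 2 isT.
Let o3 : 'I_4 := @Ordinal 4 3 isT.

Lemma sum4E (F : 'I_4 -> R) : \sum_j F j = F o0 + F o1 + F o2 + F o3.
Proof.
rewrite !big_ord_recl big_ord0 addr0 !addrA.
by congr (F _ + F _ + F _ + F _); apply/val_inj.
Qed.

Lemma ord4_ind (P : 'I_4 -> Prop) : P o0 -> P o1 -> P o2 -> P o3 -> forall j, P j.
Proof.
by move=> p0 p1 p2 p3 [[|[|[|[|//]]]] p]; rewrite (bool_irrelevance p isT).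
Qed.

Lemma sum4_le (q : 'I_4 -> R) : \sum_j q j ^+ 2 = 1 -> \sum_j q j <= 2.
Proof.
rewrite !sum4E; move: (q o0) (q o1) (q o2) (q o3) => a b c d h.
suff : (a + b + c + d) ^+ 2 <= 2 ^+ 2.
  move=> h2; apply: le_trans (ler_norm _) _.
  by rewrite -(@ger0_norm _ 2)// -ler_sqr ?nnegrE// !real_normK ?num_real.
have := sqr_ge0 (a - b); have := sqr_ge0 (a - c); have := sqr_ge0 (a - d).
have := sqr_ge0 (b - c); have := sqr_ge0 (b - d); have := sqr_ge0 (c - d).
nra.
Qed.

(** If a is the small entry, the other three sum to at most the root of [3 * (1 - a ^+ 2)]. The gap
    of 1/16 below the general bound 2 pays for one term [2^-1 ^+ k] in [treeV_config]. *)
Lemma sum4_unbalanced (q : 'I_4 -> R) (j : 'I_4) : (forall j, 0 <= q j) ->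
  \sum_j q j ^+ 2 = 1 -> q j < 1/4 -> \sum_j q j <= 31/16.
Proof.
move=> q0; rewrite !sum4E.
have g a b c d : 0 <= a -> a ^+ 2 + b ^+ 2 + c ^+ 2 + d ^+ 2 = 1 -> a < 1/4 ->
    a + b + c + d <= 31/16 :> R.
  move=> a0 e a4; rewrite leNgt; apply/negP => h.
  have c3 : (b + c + d) ^+ 2 <= 3 * (1 - a ^+ 2).
    have := sqr_ge0 (b - c); have := sqr_ge0 (b - d); have := sqr_ge0 (c - d); nra.
  have : 31/16 - a < b + c + d by lra.
  move: (b + c + d) c3 => s c3 hs; nra.
move: j; apply: ord4_ind => /= e q4.
- exact: g q4.
- by have := g (q o1) (q o0) (q o2) (q o3) (q0 _) _ q4; lra.
- by have := g (q o2) (q o1) (q o0) (q o3) (q0 _) _ q4; lra.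
- by have := g (q o3) (q o1) (q o2) (q o0) (q0 _) _ q4; lra.
Qed.

Local Notation overlap := (overlap x).

(** By Lagrange's identity, four times the sum of the squares of the [J j] minus the square of their
    sum is the sum of the squared differences over all six pairs. Each pair is thus available with
    weight [4 ^+ k], and only the pairs among children 0, 1 and 3 are spent. *)
Lemma sos_between k i N (b0 b1 b3 : R) (J := fun j : 'I_4 => lin N (overlap k.+1 (4 * i + j))) :
  b0 <= 4 ^+ k -> b1 <= 4 ^+ k -> b3 <= 4 ^+ k ->
  sos N (fun lam => \sum_(j < 4) (2 ^+ k.+1 * J j lam) ^+ 2 -
    (2 ^+ k * lin N (overlap k i) lam) ^+ 2 - (b0 * (J o3 lam - J o1 lam) ^+ 2 +
    b1 * (J o0 lam - J o3 lam) ^+ 2 + b3 * (J o1 lam - J o0 lam) ^+ 2)).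
Proof.
move=> hb0 hb1 hb3.
have sJ (c0 : R) j l : 0 <= c0 -> sos N (fun lam => c0 * (J j lam - J l lam) ^+ 2).
  move=> c00; apply: sosZ => //.
  apply: eq_sos (sos_lin N (fun n => overlap k.+1 (4 * i + j) n +
    -1 * overlap k.+1 (4 * i + l) n)) => lam.
  by rewrite linD linZ mulN1r.
have p0 : 0 <= 4 ^+ k :> R by rewrite exprn_ge0.
rewrite -!(subr_ge0 _ (4 ^+ k)) in hb0 hb1 hb3.
have H := sosD (sosD (sosD (sJ _ o3 o1 hb0) (sJ _ o0 o3 hb1))
  (sosD (sJ _ o1 o0 hb3) (sJ _ o0 o2 p0))) (sosD (sJ _ o1 o2 p0) (sJ _ o2 o3 p0)).
apply: eq_sos H => lam.
have eJ : lin N (overlap k i) lam = J o0 lam + J o1 lam + J o2 lam + J o3 lam.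
  transitivity (\sum_j J j lam); last by rewrite sum4E.
  rewrite /J -lin_sum; apply: eq_bigr => n _.
  by rewrite overlap_child.
by rewrite !sum4E eJ exp4 !exprS; ring.
Qed.

(* The corrections h give a positive drift on child 1 only, and the two
   compensating terms on children 0 and 3 do not affect the process there. *)
Lemma balanced_step k i (q : 'I_4 -> R) (c : 'I_4 -> seq (outcome R)) :
  (forall j : 'I_4, config x k.+1 (4 * i + j) (c j)) ->
  (forall j : 'I_4, inhab x k.+1 (4 * i + j)) ->
  (forall j, 1/4 <= q j) -> \sum_j q j ^+ 2 = 1 -> inhab x k i ->
  exists2 c', config x k i c' &
    gain c' = \sum_j q j * gain (c j) + 2^-1 ^+ k / 16.
Proof.
move=> cc inh q4 q1 ki.
(* With the factor 1/8, the correction on child j has Gram weight [4 ^+ k / (16 * q j ^+ 2)], which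
   is at most [4 ^+ k] exactly because [q j >= 1/4]. *)
pose u (j : 'I_4) n := 2 ^+ k.+1 / 8 * overlap k.+1 (4 * i + j) n.
pose h (j : 'I_4) n := (q j ^+ 2)^-1 * match val j with
  | 0 => u o3 n - u o1 n | 1 => u o0 n - u o3 n | 2 => 0 | _ => u o1 n - u o0 n end.
have q0 j : 0 < q j by have := q4 j; lra.
have qh (F : nat -> R) j : q j ^+ 2 * ((q j ^+ 2)^-1 * F 0) = F 0.
  by rewrite mulrA divff ?mul1r// expf_neq0// gt_eqF.
exists (merge c q h).
  apply: config_merge => //.
  - by move=> j /eqP; rewrite gt_eqF.
  - move=> n; rewrite sum4E /h /=.
    rewrite !mulrA !divff ?expf_neq0 ?gt_eqF//; ring.
  - move=> N.
    have cq j : 4 ^+ k / (16 * q j ^+ 2) <= 4 ^+ k.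
      rewrite ler_pdivrMr; last by rewrite mulr_gt0 ?exprn_gt0.
      by rewrite ler_peMr ?exprn_ge0//; have := q4 j; nra.
    apply: eq_sos (sos_between i N (cq o0) (cq o1) (cq o3)) => lam; congr (_ - _).
    have lu a b : lin N (fun n => u a n - u b n) lam = 2 ^+ k.+1 / 8 *
        (lin N (overlap k.+1 (4 * i + a)) lam - lin N (overlap k.+1 (4 * i + b)) lam).
      rewrite (_ : (fun n => _) = (fun n => 2 ^+ k.+1 / 8 * overlap k.+1 (4 * i + a) n +
        - (2 ^+ k.+1 / 8) * overlap k.+1 (4 * i + b) n)); last first.
        by apply/funext => n; rewrite /u mulNr.
      by rewrite linD !linZ mulrBr mulNr.
    have l0 : lin N (fun=> 0) lam = 0 by rewrite /lin big1// => n _; rewrite mulr0.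
    rewrite sum4E /h /= !linZ !lu l0 exp4 !exprS.
    have := q0 o0; have := q0 o1; have := q0 o3.
    move: (2 ^+ k) (q o0) (q o1) (q o3) => e a b d *; field.
    by rewrite !gt_eqF.
rewrite gain_merge big_split/=; congr (_ + _).
have su a m : \sum_(n < m) u a n = 2 ^+ k.+1 / 8 * cov k.+1 (4 * i + a) (x m).
  by rewrite -mulr_sumr; congr (_ * _); exact: sum_overlap.
have sw j (H : R) : (forall w, w \in c j -> \sum_(n < w.2) h j n = (q j ^+ 2)^-1 * H) ->
    q j ^+ 2 * \sum_(w <- c j) w.1.1 * \sum_(n < w.2) h j n = H.
  move=> e; under eq_big_seq do rewrite e//.
  by rewrite -mulr_suml; have [_ -> _ _] := cc j; rewrite inh mul1r qh.
have hs j a b m : (fun n => h j n) = (fun n => (q j ^+ 2)^-1 * (u a n - u b n)) ->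
    \sum_(n < m) h j n = (q j ^+ 2)^-1 * (2 ^+ k.+1 / 8 *
      (cov k.+1 (4 * i + a) (x m) - cov k.+1 (4 * i + b) (x m))).
  move=> e; transitivity (\sum_(n < m) (q j ^+ 2)^-1 * (u a n - u b n)).
    by apply: eq_bigr => n _; exact: (congr1 (fun f => f (val n)) e).
  by rewrite -mulr_sumr sumrB !su -mulrBr.
have cw j w : w \in c j -> cell x k.+1 w.2 = (4 * i + j)%N.
  by have [cw _ _ _] := cc j; move=> /cw[].
(* Seen from a point of child j, the children to its left are fully covered and those to its right
   not at all. Hence the differences vanish on children 0 and 3, and child 1 receives
   [2^-1 ^+ k / 16]. *)
rewrite sum4E (sw o0 0); last first.
  move=> w /cw wi; rewrite (hs _ o3 o1)// !cov_left ?subrr ?mulr0// wi ltn_add2l//.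
rewrite (sw o1 (2 ^+ k.+1 / 8 * (4 ^+ k.+1)^-1)); last first.
  move=> w /cw wi; rewrite (hs _ o0 o3)// cov_right ?cov_left ?subr0// wi ltn_add2l//.
rewrite (sw o2 0); last by move=> w _; rewrite big1 ?mulr0// => n _; rewrite /h mulr0.
rewrite (sw o3 0); last first.
  by move=> w /cw wi; rewrite (hs _ o1 o0)// !cov_right ?subrr ?mulr0// wi ltn_add2l.
rewrite exp4 !exprS exprVn !addr0 add0r; have : 2 ^+ k != 0 :> R by rewrite expf_neq0.
by move: (2 ^+ k) => e e0; field.
Qed.

(** The weights [q] are proportional to the values of the children, the equality case of
    Cauchy-Schwarz, so that the square root in the recursion becomes the sum of [q j * V j]. The
    constant 32 is halved at the next level and multiplied by the sum of the [q j]. An unbalanced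
    split leaves [31 * 2^-1 ^+ k], with room for the new term; a balanced one leaves
    [32 * 2^-1 ^+ k], and the extra gain [2^-1 ^+ k / 16], taken 16 times, pays for it. *)
Lemma treeV_config d k i : inhab x k i ->
  exists2 c, config x k i c & treeV x d k i <= 32 * 2^-1 ^+ k + 16 * gain c.
Proof.
elim: d k i => [|d IH] k i ki.
  have [c cc c0] := config_leaf x_nd x0 ki; exists c => //.
  rewrite treeV0// c0; have : 0 <= 2^-1 ^+ k :> R by rewrite exprn_ge0 ?invr_ge0.
  lra.
pose V (j : 'I_4) := treeV x d k.+1 (4 * i + j).
have /choice[c hc] : forall j : 'I_4, exists c, [/\ config x k.+1 (4 * i + j) c,
    ~~ inhab x k.+1 (4 * i + j) -> c = [::] &
    V j <= 32 * 2^-1 ^+ k.+1 + 16 * gain c].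
  move=> j; have [h|h] := boolP (inhab x k.+1 (4 * i + j)).
    by have [c cc cV] := IH _ _ h; exists c.
  exists [::]; split=> //; first exact: config_nil.
  rewrite /V treeV_empty// /gain big_nil mulr0 addr0 mulr_ge0// exprn_ge0 ?invr_ge0//.
have cc (j : 'I_4) : config x k.+1 (4 * i + j) (c j) by have [] := hc j.
have cn (j : 'I_4) : ~~ inhab x k.+1 (4 * i + j) -> c j = [::] by have [] := hc j.
have cV j : V j <= 32 * 2^-1 ^+ k.+1 + 16 * gain (c j) by have [] := hc j.
have V0 j : 0 <= V j by exact: treeV_ge0.
pose S : R := \sum_j V j ^+ 2.
have S0 : 0 < S.
  have /inhabP[n ni] := ki; have [j e _] := cell_child x_ge0 k n.
  apply: (@lt_le_trans _ _ (V j ^+ 2)).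
    by rewrite exprn_gt0// /V treeV_gt0// -ni -e inhab_cell.
  by rewrite /S (bigD1 j)//= lerDl sumr_ge0// => l _; exact: sqr_ge0.
pose D := Num.sqrt S; have D0 : 0 < D by rewrite sqrtr_gt0.
have DS : D ^+ 2 = S by rewrite sqr_sqrtr// ltW.
pose q j := V j / D.
have q0 j : 0 <= q j by rewrite divr_ge0// ltW.
have q1 : \sum_j q j ^+ 2 = 1.
  under eq_bigr do rewrite exprMn exprVn.
  by rewrite -mulr_suml DS divff// gt_eqF.
have DE : D = \sum_j q j * V j.
  under eq_bigr do rewrite /q mulrAC -expr2.
  by rewrite -mulr_suml -/S -DS expr2 mulfK// gt_eqF.
have qi (j : 'I_4) : q j != 0 -> inhab x k.+1 (4 * i + j).
  by apply: contraR => h; rewrite /q /V treeV_empty// mul0r.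
have qn j : q j = 0 -> c j = [::].
  move=> /eqP; rewrite mulf_eq0 invr_eq0 (gt_eqF D0) orbF => Vj.
  apply: cn; apply: contraL Vj => h; rewrite gt_eqF// /V treeV_gt0//.
rewrite treeVS// -/(V _) -/S -/D.
have DD : D <= 16 * 2^-1 ^+ k * \sum_j q j + 16 * \sum_j q j * gain (c j).
  rewrite DE !mulr_sumr -big_split/=; apply: ler_sum => j _.
  apply: le_trans (ler_wpM2l (q0 j) (cV j)) _.
  by rewrite exprS le_eqVlt; apply/orP; left; apply/eqP; field.
have k0 : 0 <= 2^-1 ^+ k :> R by rewrite exprn_ge0 ?invr_ge0.
have [/existsP[j qj]|] := boolP [exists j, q j < 1/4].
  have q31 := sum4_unbalanced q0 q1 qj.
  exists (merge c q (fun _ => fun=> 0)).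
    apply: config_merge => // [n|N]; first by rewrite big1// => l _; rewrite mulr0.
    have p0 : 0 <= 4 ^+ k :> R by rewrite exprn_ge0.
    apply: eq_sos (sos_between i N p0 p0 p0) => lam.
    rewrite [X in _ = _ - X]big1 ?mul0r ?addr0// => l _.
    by rewrite /lin big1 ?expr0n ?mulr0// => n _; rewrite mulr0.
  rewrite gain_merge// big_split/= [X in _ * (_ + X)]big1 ?addr0; last first.
    move=> l _; rewrite [X in _ * X]big1 ?mulr0// => w _.
    by rewrite big1 ?mulr0.
  by have := ler_wpM2l k0 q31; lra.
rewrite negb_exists => /forallP q4.
have q4' j : 1/4 <= q j by have := q4 j; rewrite -leNgt.
have qi' (j : 'I_4) : inhab x k.+1 (4 * i + j) by apply: qi; have := q4' j; lra.
have [c' cc' g'] := balanced_step cc qi' q4' q1 ki.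
exists c' => //; rewrite g'.
have := ler_wpM2l k0 (sum4_le q1); lra.
Qed.

End lower_bound.

(** * Frames with a prescribed diagonal Gram form *)

Section frames.
Variables (R : realType) (a : nat -> R).

(* Finite families of vectors whose Gram form is diag(a_n^2), each one marked
   with the index at which its partial sum is evaluated. *)
Definition frame N (s : seq ((nat -> R) * nat)) :=
  (forall lam, \sum_(w <- s) lin N w.1 lam ^+ 2 = \sum_(n < N) lam n ^+ 2 * a n ^+ 2) /\
  (forall w, w \in s -> (w.2 <= N)%N).

(** With the vectors as atoms of a counting measure, a lower bound for the second moment of the
    maximal partial sum. *)
Definition energy (s : seq ((nat -> R) * nat)) : R :=
  \sum_(w <- s) (\sum_(n < w.2) w.1 n) ^+ 2.

Definition psum n : R := \sum_(0 <= i < n) a i ^+ 2.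

Lemma psumS n : psum n.+1 = psum n + a n ^+ 2.
Proof. by rewrite /psum big_nat_recr. Qed.

Lemma psum0 : psum 0 = 0.
Proof. by rewrite /psum big_geq. Qed.

Lemma psum_nd : nondecreasing_seq psum.
Proof. by apply/nondecreasing_seqP => n; rewrite psumS lerDl sqr_ge0. Qed.

Lemma psum_ge0 n : 0 <= psum n.
Proof. by rewrite -psum0; exact: psum_nd. Qed.

Lemma lin_delta N n (v : nat -> R) : (n < N)%N -> lin N v (fun m => (m == n)%:R) = v n.
Proof.
move=> nN; rewrite /lin (bigD1 (Ordinal nN))//= eqxx mul1r big1 ?addr0// => m.
by rewrite -val_eqE/= => /negbTE->; rewrite mul0r.
Qed.

(** Polarisation: the form is evaluated at the coordinate vectors and at their sums. *)
Lemma frame_gram N s n m : frame N s -> (n < N)%N -> (m < N)%N ->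
  \sum_(w <- s) w.1 n * w.1 m = (n == m)%:R * a n ^+ 2.
Proof.
move=> [fs _] nN mN.
have e1 p : (p < N)%N -> \sum_(w <- s) w.1 p ^+ 2 = a p ^+ 2.
  move=> pN; have := fs (fun m => (m == p)%:R).
  under eq_bigr do rewrite lin_delta//.
  move=> ->; rewrite (bigD1 (Ordinal pN))//= eqxx expr1n mul1r big1 ?addr0// => l.
  by rewrite -val_eqE/= => /negbTE->; rewrite expr0n mul0r.
have [->|nm] := eqVneq n m; first by rewrite mul1r -e1.
rewrite mul0r.
have := fs (fun l => (l == n)%:R + (l == m)%:R).
have linDl (v f g : nat -> R) : lin N v (fun l => f l + g l) = lin N v f + lin N v g.
  by rewrite /lin -big_split/=; apply: eq_bigr => l _; rewrite mulrDl.
under eq_bigr do rewrite linDl !lin_delta// sqrrD.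
rewrite !big_split/= !e1//.
have -> : \sum_(l < N) ((l == n :> nat)%:R + (l == m :> nat)%:R) ^+ 2 * a l ^+ 2 = a n ^+ 2 + a m ^+ 2.
  rewrite (bigD1 (Ordinal nN))//= (bigD1 (Ordinal mN)) /=; last by rewrite -val_eqE/= eq_sym.
  rewrite !eqxx [m == n]eq_sym (negbTE nm) addr0 add0r expr1n !mul1r big1 ?addr0// => l.
  by rewrite -!val_eqE/= => /andP[/negbTE-> /negbTE->]; rewrite addr0 expr0n mul0r.
by move=> h; lra.
Qed.

(** The coordinate vectors, all evaluated at [N]: bounded energies therefore force the sum of the
    [a n ^+ 2] to be finite. *)
Lemma trivial_frame N : exists2 s, frame N s & energy s = psum N.
Proof.
exists [seq ((fun n => (n == j)%:R * a j), N) | j <- iota 0 N]; last first.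
  rewrite /energy big_map /psum /index_iota subn0 !big_seq; apply: eq_bigr => j.
  rewrite mem_iota add0n/= => jN.
  rewrite (bigD1 (Ordinal jN))//= eqxx mul1r big1 ?addr0// => l.
  by rewrite -val_eqE/= => /negbTE->; rewrite mul0r.
split=> [lam|w /mapP[j _ ->]//].
rewrite big_map -(big_mkord xpredT (fun n => lam n ^+ 2 * a n ^+ 2)) /index_iota subn0 !big_seq.
apply: eq_bigr => j; rewrite mem_iota add0n/= => jN.
rewrite /lin (bigD1 (Ordinal jN))//= eqxx mul1r big1 ?addr0 ?exprMn// => l.
by rewrite -val_eqE/= => /negbTE->; rewrite mul0r mulr0.
Qed.

Section normalized.
Variable l : R.
Hypothesis psum_lt : forall n, psum n < l.

Let x n := psum n / l.

Let l0 : 0 < l. Proof. by rewrite -psum0. Qed.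

Lemma x_ge0 n : 0 <= x n. Proof. by rewrite divr_ge0 ?psum_ge0// ltW. Qed.

Lemma x_lt1 n : x n < 1. Proof. by rewrite ltr_pdivrMr// mul1r. Qed.

Lemma x_nd n : x n <= x n.+1.
Proof. by rewrite ler_pM2r ?invr_gt0// psum_nd. Qed.

Lemma x_0 : x 0 = 0. Proof. by rewrite /x psum0 mul0r. Qed.

Lemma overlap_root n : overlap x 0 0 n = a n ^+ 2 / l.
Proof.
have c m : cov 0 0 (x m) = x m.
  by rewrite /cov /qpt !expr0 !divr1 min_l ?min_r ?subr0 ?x_ge0// ltW// x_lt1.
by rewrite /overlap !c /x psumS -mulrBl addrAC subrr add0r.
Qed.

(** The outcomes, scaled by the root of [l] times their weight, are completed to the required Gram
    form by the vectors certifying the slack inequality and by the vector of the mean over the root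
    cell. The added vectors are evaluated at index 0 and carry no energy; the energy bound says that
    a second moment is at least the square of the mean. *)
Lemma frame_config (c : seq (outcome R)) : config x 0 0 c ->
  exists N s, frame N s /\ l * gain c ^+ 2 <= energy s.
Proof.
move=> [c1 c2 c3 c4].
pose N := \max_(w <- c) w.2.
have wN w : w \in c -> (w.2 <= N)%N.
  move=> wc; rewrite /N; elim: (c) wc => [//|v r IH].
  rewrite inE big_cons => /orP[/eqP->|/IH h]; first exact: leq_maxl.
  exact: leq_trans h (leq_maxr _ _).
have [s sE] := c4 N.
pose s1 := [seq ((fun n => Num.sqrt (l * w.1.1) * w.1.2 n), w.2) | w <- c].
pose s2 := [seq ((fun n => Num.sqrt l * v n), 0%N) | v <- s].
pose s3 := [:: ((fun n => Num.sqrt l * overlap x 0 0 n), 0%N)].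
exists N, (s1 ++ s2 ++ s3); split; last first.
  rewrite /energy !big_cat/= !big_map big_seq1 /= big_ord0 expr0n addr0.
  rewrite [X in _ <= _ + X]big1 ?addr0; last by move=> v _; rewrite big_ord0 expr0n.
  have i0 : inhab x 0 0 by apply/inhabP; exists 0; rewrite cell0//; [exact: x_ge0|exact: x_lt1].
  rewrite i0 in c2.
  set X := fun w : outcome R => \sum_(n < w.2) w.1.2 n.
  have -> : \sum_(w <- c) (\sum_(n < w.2) Num.sqrt (l * w.1.1) * w.1.2 n) ^+ 2 =
      l * \sum_(w <- c) w.1.1 * X w ^+ 2.
    rewrite mulr_sumr !big_seq; apply: eq_bigr => w /c1[w0 _].
    by rewrite -mulr_sumr exprMn sqr_sqrtr ?mulrA// mulr_ge0// ltW.
  rewrite ler_pM2l//.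
  have : 0 <= \sum_(w <- c) w.1.1 * (X w - gain c) ^+ 2.
    by rewrite big_seq sumr_ge0// => w /c1[w0 _]; rewrite mulr_ge0// sqr_ge0.
  have e (Y : outcome R -> R) g : \sum_(w <- c) w.1.1 * (Y w - g) ^+ 2 =
      \sum_(w <- c) w.1.1 * Y w ^+ 2 + (- 2 * g * \sum_(w <- c) w.1.1 * Y w +
      g ^+ 2 * \sum_(w <- c) w.1.1).
    by rewrite !mulr_sumr -!big_split/=; apply: eq_bigr => w _; ring.
  have eg : \sum_(w <- c) w.1.1 * X w = gain c by [].
  have c2' : \sum_(w <- c) w.1.1 = 1 by rewrite c2.
  by rewrite e c2' eg; move: (gain c) (\sum_(w <- c) _) => g S; nra.
split=> [lam|w]; last first.
  rewrite !mem_cat => /orP[/mapP[v vc ->]|/orP[/mapP[v _ ->//]|]]; first exact: wN.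
  by rewrite inE => /eqP->.
rewrite !big_cat/= !big_map big_seq1/= linZ.
under [X in _ + (X + _)]eq_bigr do rewrite linZ exprMn sqr_sqrtr ?(ltW l0)//.
rewrite -mulr_sumr -sE exprMn sqr_sqrtr ?(ltW l0)//.
have -> : \sum_(w <- c) lin N (fun n => Num.sqrt (l * w.1.1) * w.1.2 n) lam ^+ 2 =
    l * \sum_(w <- c) w.1.1 * lin N w.1.2 lam ^+ 2.
  rewrite mulr_sumr !big_seq; apply: eq_bigr => w /c1[w0 _].
  by rewrite linZ exprMn sqr_sqrtr ?mulrA// mulr_ge0// ltW.
rewrite /slack expr0 mul1r.
have <- : l * \sum_(n < N) lam n ^+ 2 * overlap x 0 0 n = \sum_(n < N) lam n ^+ 2 * a n ^+ 2.
  rewrite mulr_sumr; apply: eq_bigr => n _; rewrite overlap_root.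
  by rewrite mulrCA [l * _]mulrC divfK// gt_eqF.
by ring.
Qed.

Lemma treeV_frame_bounded K : (forall N s, frame N s -> energy s <= K) ->
  exists B, forall d, treeV x d 0 0 <= B.
Proof.
move=> fK; exists (32 + 16 * Num.sqrt (K / l)) => d.
have i0 : inhab x 0 0 by apply/inhabP; exists 0; rewrite cell0//; [exact: x_ge0|exact: x_lt1].
have [c cc cV] := treeV_config x_ge0 x_nd x_0 d i0.
apply: le_trans cV _; rewrite expr0 mulr1 lerD2l ler_pM2l//.
have [N [s [fs le_s]]] := frame_config cc.
apply: le_trans (ler_norm _) _; rewrite -sqrtr_sqr ler_wsqrtr// ler_pdivlMr// mulrC.
exact: le_trans le_s (fK _ _ fs).
Qed.

End normalized.
End frames.

(** * Divergence of an orthonormal series *)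

Section finite_blocks.
Variables (R : realType) (a : nat -> R).
Hypothesis a_gt0 : forall n, 0 < a n.

Lemma sqr_sum_le (m : nat) (v : nat -> R) :
  (\sum_(n < m) v n) ^+ 2 <= m%:R * \sum_(n < m) v n ^+ 2.
Proof.
have : 0 <= \sum_(n < m) \sum_(l < m) (v n - v l) ^+ 2.
  by apply: sumr_ge0 => n _; apply: sumr_ge0 => l _; exact: sqr_ge0.
have -> : \sum_(n < m) \sum_(l < m) (v n - v l) ^+ 2 =
    2 * (m%:R * \sum_(n < m) v n ^+ 2) - 2 * (\sum_(n < m) v n) ^+ 2.
  have e1 : m%:R * \sum_(n < m) v n ^+ 2 = \sum_(n < m) \sum_(l < m) v n ^+ 2.
    rewrite mulr_sumr; apply: eq_bigr => n _.
    by rewrite sumr_const card_ord mulr_natl.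
  have e2 : m%:R * \sum_(n < m) v n ^+ 2 = \sum_(n < m) \sum_(l < m) v l ^+ 2.
    by rewrite e1 exchange_big.
  have -> : 2 * (m%:R * \sum_(n < m) v n ^+ 2) = m%:R * \sum_(n < m) v n ^+ 2 +
      m%:R * \sum_(n < m) v n ^+ 2 by ring.
  rewrite {1}e1 e2 expr2 big_distrlr/= mulr_sumr -sumrN -!big_split/=.
  apply: eq_bigr => n _; rewrite mulr_sumr -sumrN -!big_split/=.
  by apply: eq_bigr => l _; ring.
by lra.
Qed.

(** By Cauchy-Schwarz and the diagonal of the Gram form, the first [M] coordinates account for at
    most [M%:R * psum a M], a quantity independent of the frame. *)
Lemma frame_tail N s M K : frame a N s -> 2 * (M%:R * psum a M) + 2 * K <= energy s ->
  K <= \sum_(w <- s) (\sum_(M <= n < w.2) w.1 n) ^+ 2.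
Proof.
move=> fs; pose p (w : (nat -> R) * nat) := minn M w.2.
pose hd w : R := \sum_(0 <= n < p w) w.1 n.
pose tl (w : (nat -> R) * nat) : R := \sum_(M <= n < w.2) w.1 n.
have XE (w : (nat -> R) * nat) : \sum_(n < w.2) w.1 n = hd w + tl w.
  rewrite -(big_mkord xpredT) /hd /tl /p; have [Mw|wM] := leqP M w.2.
    by rewrite -big_cat_nat.
  by rewrite [X in _ + X]big_geq ?addr0// ltnW.
have hdM : \sum_(w <- s) hd w ^+ 2 <= M%:R * psum a M.
  have [_ fN] := fs.
  apply: (@le_trans _ _ (\sum_(w <- s) M%:R * \sum_(n < minn M N) w.1 n ^+ 2)).
    rewrite big_seq [leRHS]big_seq; apply: ler_sum => w /fN wN.
    rewrite /hd big_mkord; apply: le_trans (sqr_sum_le _ _) _.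
    apply: ler_pM => //; first by apply: sumr_ge0 => n _; exact: sqr_ge0.
      by rewrite ler_nat geq_minl.
    have pN : (p w <= minn M N)%N by rewrite leq_min geq_minl (leq_trans (geq_minr _ _)).
    rewrite -(big_mkord xpredT (fun n => w.1 n ^+ 2)) -(big_mkord xpredT (fun n => w.1 n ^+ 2)).
    rewrite [leRHS](@big_cat_nat _ _ _ (p w))//= lerDl.
    by apply: sumr_ge0 => n _; exact: sqr_ge0.
  rewrite -mulr_sumr ler_wpM2l// exchange_big/=.
  apply: (@le_trans _ _ (psum a (minn M N))); last by apply: psum_nd; exact: geq_minl.
  rewrite /psum big_mkord; apply: ler_sum => n _.
  have nN : (n < N)%N by rewrite (leq_trans (ltn_ord n))// geq_minr.
  have := frame_gram fs nN nN; rewrite eqxx mul1r => <-.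
  by rewrite le_eqVlt; apply/orP; left; apply/eqP; apply: eq_bigr => w _; rewrite expr2.
have -> : energy s = \sum_(w <- s) (hd w + tl w) ^+ 2.
  by apply: eq_bigr => w _; rewrite XE.
have : \sum_(w <- s) (hd w + tl w) ^+ 2 <=
    2 * \sum_(w <- s) hd w ^+ 2 + 2 * \sum_(w <- s) tl w ^+ 2.
  rewrite !mulr_sumr -big_split/=; apply: ler_sum => w _.
  by have := sqr_ge0 (hd w - tl w); nra.
by rewrite -/(tl _); lra.
Qed.

(* Each vector v is replaced by r copies of v / sqrt (2 r) and of
   - v / sqrt (2 r), with r about proportional to the squared block sum of v;
   then most of the atoms have a large block sum. *)
Lemma block_system M : (forall K, exists N s, frame a N s /\ K <= energy s) ->
  exists N Q (psi : nat -> nat -> R), [/\ (M < N)%N, (0 < Q)%N,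
    forall n m, (M <= n < N)%N -> (M <= m < N)%N ->
      \sum_(i < Q) psi n i * psi m i = (n == m)%:R * Q%:R,
    forall n, (M <= n < N)%N -> \sum_(i < Q) psi n i = 0 &
    (Q <= 2 * \sum_(i < Q) [exists k : 'I_N.+1, (1 <= `|\sum_(M <= n < k) a n * psi n i|)%R])%N].
Proof.
(* A tail energy of at least 4 yields [Q >= 8 W] below, against which the at most [2 W] bad atoms
   are few. *)
move=> big; have [N [s [fs Ks]]] := big (2 * (M%:R * psum a M) + 2 * 4).
pose y (w : (nat -> R) * nat) := \sum_(M <= n < w.2) w.1 n.
have y4 : 4 <= \sum_(w <- s) y w ^+ 2 := frame_tail fs Ks.
have [_ fN] := fs.
have MN : (M < N)%N.
  rewrite ltnNge; apply/negP => NM; move: y4; rewrite big_seq big1 ?ler0n => [|w /fN wN].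
    by rewrite leNgt ltr0n.
  by rewrite /y big_geq ?expr0n// (leq_trans wN).
pose W := size s; pose r w := (Num.truncn (W%:R * y w ^+ 2)).+1.
have Wy0 w : 0 <= W%:R * y w ^+ 2 by rewrite mulr_ge0// sqr_ge0.
have W0 : (0 < W)%N.
  rewrite lt0n; apply/eqP => /size0nil s0; move: y4; rewrite s0 big_nil.
  by rewrite leNgt ltr0n.
pose c w : R := (Num.sqrt (2 * (r w)%:R))^-1.
have r0 w : 0 < 2 * (r w)%:R :> R by rewrite mulr_gt0// ltr0n.
have c2 w : c w ^+ 2 = (2 * (r w)%:R)^-1 by rewrite exprVn sqr_sqrtr// ltW.
pose pos w n : R := c w * w.1 n; pose neg w n : R := - pos w n.
pose atoms := flatten [seq nseq (r w) (pos w) ++ nseq (r w) (neg w) | w <- s].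
pose Q := size atoms.
have sum_atoms (F : (nat -> R) -> R) :
    \sum_(i < Q) F (nth (fun=> 0) atoms i) = \sum_(w <- s) (r w)%:R * (F (pos w) + F (neg w)).
  rewrite -(big_mkord xpredT (fun i => F (nth _ atoms i))) -(big_nth (fun=> 0) xpredT).
  rewrite big_flatten big_map; apply: eq_bigr => w _.
  by rewrite big_cat !big_nseq !iter_addr_0 mulr_natl mulrnDl.
have QE : Q%:R = \sum_(w <- s) 2 * (r w)%:R :> R.
  have := sum_atoms (fun=> 1); rewrite sumr_const card_ord => ->.
  by apply: eq_bigr => w _; ring.
have Q8 : 8 * W%:R <= Q%:R :> R.
  rewrite QE; apply: (@le_trans _ _ (2 * (W%:R * \sum_(w <- s) y w ^+ 2))).
    by have := ler_wpM2l (ler0n R W) y4; lra.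
  rewrite !mulr_sumr; apply: ler_sum => w _; rewrite ler_pM2l//.
  by have /andP[_ /ltW] := truncn_itv (Wy0 w).
have Q0 : 0 < Q%:R :> R by apply: lt_le_trans Q8; rewrite mulr_gt0// ltr0n.
pose psi n i := Num.sqrt Q%:R / a n * nth (fun=> 0) atoms i n.
exists N, Q, psi; split => //.
- by rewrite -(ltr0n R).
- move=> n m /andP[_ nN] /andP[_ mN].
  have an := lt0r_neq0 (a_gt0 n); have am := lt0r_neq0 (a_gt0 m).
  rewrite (sum_atoms (fun u => (Num.sqrt Q%:R / a n * u n) * (Num.sqrt Q%:R / a m * u m))).
  transitivity (Q%:R / (a n * a m) * \sum_(w <- s) w.1 n * w.1 m).
    rewrite mulr_sumr; apply: eq_bigr => w _; rewrite /neg /pos.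
    rewrite -[X in _ = X / _ * _](sqr_sqrtr (ltW Q0)).
    have e : (r w)%:R * (2 * c w ^+ 2) = 1 by rewrite c2 mulrCA mulrA divff// lt0r_neq0.
    transitivity ((r w)%:R * (2 * c w ^+ 2) * (Num.sqrt Q%:R ^+ 2 / (a n * a m) * (w.1 n * w.1 m))).
      by move: (r w)%:R (c w) (Num.sqrt _) => rw cw q; field; rewrite an am.
    by rewrite e mul1r.
  rewrite (frame_gram fs)//; have [->|] := eqVneq n m; last by rewrite !mul0r mulr0.
  by rewrite !mul1r expr2 divfK// mulf_neq0.
(* The two signs cancel; this zero mean is what makes different blocks orthogonal later. *)
- move=> n _; rewrite (sum_atoms (fun u => Num.sqrt Q%:R / a n * u n)) big1// => w _.
  by rewrite -mulrDr /neg subrr mulr0 mulr0.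
pose G (u : nat -> R) := [exists k : 'I_N.+1, 1 <= `|Num.sqrt Q%:R * \sum_(M <= n < k) u n|].
have GE i : [exists k : 'I_N.+1, 1 <= `|\sum_(M <= n < k) a n * psi n i|] =
    G (nth (fun=> 0) atoms i).
  apply: eq_existsb => k; congr (1 <= `|_|); rewrite mulr_sumr; apply: eq_bigr => n _.
  by rewrite mulrA mulrCA divff ?mulr1// lt0r_neq0.
under eq_bigr do rewrite GE.
have Gs : \sum_(i < Q) (G (nth (fun=> 0) atoms i))%:R =
  \sum_(w <- s) (r w)%:R * ((G (pos w))%:R + (G (neg w))%:R) :> R := sum_atoms (fun u => (G u)%:R).
(* If [W * y w ^+ 2 >= 1], then [r w <= 2 * W * y w ^+ 2], so [Q >= 8 W] makes the squared block sum
   [Q * y w ^+ 2 / (2 * r w)] at least 1. Any other vector has a single copy of each sign, which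
   costs at most [2 W] atoms in all. *)
have Gge : Q%:R - 2 * W%:R <= \sum_(i < Q) (G (nth (fun=> 0) atoms i))%:R :> R.
  rewrite Gs QE /W -sum1_size natr_sum mulr_sumr -sumrB big_seq [leRHS]big_seq.
  apply: ler_sum => w ws.
  have rE : (r w)%:R <= W%:R * y w ^+ 2 + 1.
    by rewrite -natr1 lerD2r; have /andP[] := truncn_itv (Wy0 w).
  have [Wy1|Wy1] := ltP (W%:R * y w ^+ 2) 1.
    have -> : r w = 1%N by rewrite /r (@truncn_def _ _ 0%N)// Wy0.
    by rewrite mulr1 subrr mul1r addr_ge0.
  have big1' : 1 <= (Num.sqrt Q%:R * (c w * y w)) ^+ 2.
    rewrite exprMn sqr_sqrtr ?(ltW Q0)// exprMn c2 mulrCA ler_pdivlMl// mulr1.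
    by have := ler_wpM2r (sqr_ge0 (y w)) Q8; nra.
  have Gw : 1 <= `|Num.sqrt Q%:R * (c w * y w)|.
    by rewrite -(@ler_sqr _ 1) ?nnegrE// expr1n real_normK ?num_real.
  have wN : (w.2 < N.+1)%N by rewrite ltnS fN.
  have -> : G (pos w).
    by apply/existsP; exists (Ordinal wN); rewrite /= -mulr_sumr.
  have -> : G (neg w).
    by apply/existsP; exists (Ordinal wN); rewrite /= sumrN mulrN normrN -mulr_sumr.
  by rewrite /=; lra.
rewrite -(ler_nat R) natrM natr_sum; lra.
Qed.

End finite_blocks.

(** * Step functions under the uniform measure on the unit interval *)

Section uniform_step_functions.
Variable R : realType.

Definition unif : probability (measurableTypeR R) R := uniform_prob (@ltr01 R).

Definition ucell (Q : nat) (x : R) : nat := Num.truncn (Q%:R * x).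

(** The guard gives the value 0 for [x >= 1] when [Q] is positive. Negative numbers fall into cell 0
    by truncation, but they are a null set for [unif]. *)
Definition stepf Q (f : nat -> R) (x : R) : R :=
  if (ucell Q x < Q)%N then f (ucell Q x) else 0.

Lemma measurable_ucell Q (i : nat) : measurable [set x : R | ucell Q x = i].
Proof.
have m n : measurable [set x : R | (ucell Q x <= n)%N].
  rewrite (_ : [set _ | _] = (fun x : R => Q%:R * x) @^-1` `]-oo, n.+1%:R[); last first.
    by apply/seteqP; split=> x /=; rewrite in_itv/= /ucell truncn_le_nat.
  rewrite -[X in measurable X]setTI.
  by apply: mulrl_measurable; [exact: measurableT|exact: measurable_itv].
case: i => [|i].
  rewrite (_ : [set _ | _] = [set x : R | (ucell Q x <= 0)%N])//.
  by apply/seteqP; split=> x /=; rewrite leqn0 => /eqP.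
rewrite (_ : [set _ | _] = [set x : R | (ucell Q x <= i.+1)%N] `\` [set x : R | (ucell Q x <= i)%N]).
  exact: measurableD.
apply/seteqP; split=> x /=; first by move=> ->; split=> //; rewrite ltnn.
by move=> [h /negP]; rewrite -ltnNge => h'; apply/eqP; rewrite eqn_leq h.
Qed.

Lemma unif_ucell Q (i : nat) : (i < Q)%N -> unif [set x : R | ucell Q x = i] = (Q%:R^-1)%:E.
Proof.
move=> iQ; have Q0 : 0 < Q%:R :> R by rewrite ltr0n (leq_ltn_trans _ iQ).
rewrite [LHS](_ : _ = \int[lebesgue_measure]_(x in [set x | ucell Q x = i]) (uniform_pdf 0 1 x)%:E)%E//.
rewrite integral_uniform_pdf.
(* Intersecting with the support removes the negative numbers that truncation puts in cell 0. *)
have -> : [set x : R | ucell Q x = i] `&` `[0, 1] = `[i%:R / Q%:R, i.+1%:R / Q%:R[%classic.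
  apply/seteqP; split=> x /=; rewrite !in_itv/= ler_pdivrMr// ltr_pdivlMr// (mulrC x).
    by move=> [<- /andP[x0 x1]]; apply: truncn_itv; rewrite mulr_ge0// ltW.
  move=> /andP[h1 h2]; split; first by rewrite /ucell; apply: truncn_def; rewrite h1 h2.
  have x0 : 0 <= Q%:R * x by apply: le_trans h1.
  rewrite (pmulr_rge0 _ Q0) in x0; rewrite x0/=.
  rewrite -(ler_pM2l Q0) mulr1; apply: le_trans (ltW h2) _.
  by rewrite ler_nat.
rewrite (eq_integral (fun=> 1%E)); last first.
  move=> x; rewrite inE/= in_itv/= => /andP[h1 h2]; rewrite /uniform_pdf subr0 invr1.
  have x0 : 0 <= x by apply: le_trans h1; rewrite divr_ge0// ltW.
  have x1 : x <= 1.
    apply: le_trans (ltW h2) _; rewrite ler_pdivrMr// mul1r ler_nat//.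
  by rewrite x0 x1.
rewrite integral_cst//= mul1e lebesgue_measure_itv/= lte_fin ltr_pM2r ?invr_gt0// ltr_nat ltnSn.
by rewrite -EFinD -mulrBl -natrB// subSnn mul1r.
Qed.

Lemma stepfE Q f : stepf Q f = (fun x => \sum_(i < Q) f i * \1_[set x | ucell Q x = i] x).
Proof.
apply/funext => x; rewrite /stepf; case: ifPn => [h|].
  rewrite (bigD1 (Ordinal h))//= indicE mem_set// mulr1 big1 ?addr0// => j.
  rewrite -val_eqE/= eq_sym => /eqP jx; rewrite indicE memNset ?mulr0//.
rewrite -leqNgt => h; rewrite big1// => j _; rewrite indicE memNset ?mulr0//= => e.
by move: h; rewrite e leqNgt ltn_ord.
Qed.

Lemma measurable_stepf Q f : measurable_fun setT (stepf Q f).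
Proof.
rewrite stepfE; apply: measurable_sum => i.
by apply: measurable_funM => //; apply: measurable_indic; exact: measurable_ucell.
Qed.

Lemma expectation_stepf Q f : (\int[unif]_x (stepf Q f x)%:E)%E =
  ((\sum_(i < Q) f i) / Q%:R)%:E.
Proof.
rewrite stepfE; under eq_integral do rewrite -sumEFin.
have ii (i : nat) : unif.-integrable setT (fun x => (f i * \1_[set x | ucell Q x = i] x)%:E).
  under eq_fun do rewrite EFinM; apply: integrableZl => //.
  by apply: integrable_indic => //; exact: measurable_ucell.
rewrite integral_sum//= mulr_suml -sumEFin; apply: eq_bigr => i _.
under eq_integral do rewrite EFinM.
rewrite integralZl//=; last first.
  by apply: integrable_indic => //; exact: measurable_ucell.
rewrite integral_indic//; last exact: measurable_ucell.
by rewrite setIT EFinM; congr (_ * _)%E; exact: unif_ucell.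
Qed.

Lemma ucell_coarse q Q (x : R) : (0 < q)%N -> ucell Q x = (ucell (Q * q) x %/ q)%N.
Proof.
move=> q0; have q0' : 0 < q%:R :> R by rewrite ltr0n.
have [x0|x0] := leP 0 x; last first.
  have t0 n : ucell n x = 0%N.
    apply/eqP; rewrite -leqn0 truncn_le_nat; apply: le_lt_trans (@ltr01 R).
    by rewrite mulr_ge0_le0// ltW.
  by rewrite !t0 div0n.
apply: truncn_def.
have /andP[h1 h2] : (ucell (Q * q) x)%:R <= (Q * q)%:R * x < (ucell (Q * q) x).+1%:R.
  by apply: truncn_itv; rewrite mulr_ge0.
move: h1 h2; rewrite natrM => h1 h2.
apply/andP; split.
  rewrite -(ler_pM2l q0') mulrA [q%:R * Q%:R]mulrC; apply: le_trans h1.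
  by rewrite -natrM ler_nat mulnC leq_trunc_div.
rewrite -(ltr_pM2l q0') mulrA [q%:R * Q%:R]mulrC; apply: lt_le_trans h2 _.
by rewrite -natrM ler_nat [(q * _)%N]mulnC ltn_ceil.
Qed.

Lemma ucell_lt Q (x : R) : (0 < Q)%N -> (ucell Q x < Q)%N = (x < 1).
Proof.
case: Q => // Q _; rewrite ltnS /ucell truncn_le_nat.
by rewrite -{2}[Q.+1%:R]mulr1 ltr_pM2l.
Qed.

Lemma stepf_refine q Q f : (0 < q)%N -> (0 < Q)%N ->
  stepf Q f = stepf (Q * q) (fun i => f (i %/ q)%N).
Proof.
move=> q0 Q0; apply/funext => x.
by rewrite /stepf !ucell_lt ?muln_gt0 ?Q0// -ucell_coarse.
Qed.

End uniform_step_functions.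

(** * Digits in a mixed radix as independent variables *)

Section digits.
Variables (R : realType) (Q : nat -> nat).
Hypothesis Q_gt0 : forall j, (0 < Q j)%N.

Let Pi j := (\prod_(i < j) Q i)%N.

Let PiS j : Pi j.+1 = (Pi j * Q j)%N. Proof. by rewrite /Pi big_ord_recr. Qed.

Let Pi_gt0 j : (0 < Pi j)%N.
Proof. by rewrite /Pi prodn_gt0. Qed.

(* A function of the j-th digit of x in the mixed radix Q. *)
Definition digitf j (f : nat -> R) : R -> R := stepf (Pi j.+1) (fun z => f (z %% Q j)%N).

Lemma measurable_digitf j f : measurable_fun setT (digitf j f).
Proof. exact: measurable_stepf. Qed.

Definition digit_rv j f : {RV (unif R) >-> R} :=
  @mfun_Sub _ _ (measurableTypeR R) R (digitf j f) (mem_set (measurable_digitf j f)).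

Lemma sum_divmod A B (F : nat -> nat -> R) : (0 < B)%N ->
  \sum_(z < A * B) F (z %/ B)%N (z %% B)%N = \sum_(y < A) \sum_(d < B) F y d.
Proof.
move=> B0; rewrite -(big_mkord xpredT (fun z => F (z %/ B)%N (z %% B)%N)) big_nat_mul big_mkord.
apply: eq_bigr => y _; rewrite mulSn -{1}[(y * B)%N]add0n big_addn addnK big_mkord.
by apply: eq_bigr => d _; rewrite addnC divnMDl// modnMDl divn_small// modn_small ?addn0.
Qed.

Lemma integral_digitf j f : (\int[@unif R]_x (digitf j f x)%:E)%E =
  ((\sum_(d < Q j) f d) / (Q j)%:R)%:E.
Proof.
rewrite expectation_stepf PiS (sum_divmod _ (fun _ d => f d))// sumr_const card_ord.
have q0 : (Q j)%:R != 0 :> R by rewrite pnatr_eq0 -lt0n.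
have p0 : (Pi j)%:R != 0 :> R by rewrite pnatr_eq0 -lt0n.
rewrite -[_ *+ _]mulr_natl natrM; congr (_%:E).
by field; rewrite q0.
Qed.

Lemma digitfM j f g x : digitf j f x * digitf j g x = digitf j (fun d => f d * g d) x.
Proof. by rewrite /digitf /stepf; case: ifP; rewrite ?mul0r. Qed.

(** On the common partition into [Pi j.+1] cells, fixing the digits before the j-th one fixes the
    first factor, and the sum over the j-th digit vanishes. *)
Lemma integral_digitf2 i j (f g : nat -> R) : (i < j)%N -> \sum_(d < Q j) g d = 0 ->
  (\int[@unif R]_x (digitf i f x * digitf j g x)%:E = 0)%E.
Proof.
move=> ij g0; pose q := (\prod_(i.+1 <= l < j) Q l)%N.
have q0 : (0 < q)%N by rewrite /q prodn_gt0.
have PE : Pi j.+1 = (Pi i.+1 * (q * Q j))%N.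
  rewrite PiS mulnA /q /Pi -!(big_mkord xpredT Q) -big_cat_nat//.
have qQ0 : (0 < q * Q j)%N by rewrite muln_gt0 q0 Q_gt0.
rewrite /digitf (stepf_refine _ qQ0 (Pi_gt0 i.+1)).
have -> : (fun x : R => (stepf (Pi i.+1 * (q * Q j)) (fun z => f (z %/ (q * Q j) %% Q i)%N) x *
    stepf (Pi j.+1) (fun z => g (z %% Q j)%N) x)%:E) =
  (fun x => (stepf (Pi j.+1) (fun z => f (z %/ Q j %/ q %% Q i)%N * g (z %% Q j)%N) x)%:E).
  apply/funext => x; rewrite -PE /stepf; case: ifP; last by rewrite mul0r.
  by rewrite [(q * _)%N]mulnC divnMA.
rewrite expectation_stepf PiS (sum_divmod _ (fun y d => f (y %/ q %% Q i)%N * g d))//.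
rewrite big1 ?mul0r// => y _.
by rewrite -mulr_sumr g0 mulr0.
Qed.

End digits.

(** * A divergent orthonormal series from blocks on successive digits *)

Section divergence.
Variables (R : realType) (a : nat -> R).
Hypothesis a_gt0 : forall n, 0 < a n.

Definition ae_convergent := forall (d : measure_display) (Omega : measurableType d)
    (P : probability Omega R) (phi : nat -> {RV P >-> R}),
  orthonormal_sequence phi ->
  {ae P, forall w, cvgn (series (fun n => a n * phi n w))}.

(** The points that lie in only finitely many [A j] form the increasing union of the sets [D J],
    each contained in the complement of [A J] and so of measure at most 1/2. *)
Lemma not_ae_limsup (A : nat -> set (measurableTypeR R)) (C : set (measurableTypeR R)) :
  (forall j, measurable (A j)) -> (forall j, ((1/2)%:E <= unif R (A j))%E) ->
  (forall x, C x -> exists J, forall j, (J <= j)%N -> ~ A j x) ->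
  ~ {ae unif R, forall x, C x}.
Proof.
move=> mA A2 CA [N [mN N0 CN]].
pose D J := \bigcap_(j in [set j | (J <= j)%N]) ~` A j.
have mD J : measurable (D J).
  apply: bigcap_measurable => [|j _]; first by exists J => /=.
  exact: measurableC.
have mUD : measurable (\bigcup_J D J) by apply: bigcup_measurable.
have DJ J : (unif R (D J) <= (1/2)%:E)%E.
  apply: (@le_trans _ _ (unif R (~` A J))).
    by apply: le_measure; rewrite ?inE//; [exact: measurableC|move=> x /(_ J); apply => /=].
  rewrite probability_setC//; have := A2 J.
  have : (unif R (A J)) \is a fin_num by rewrite fin_num_measure.
  case: (unif R (A J)) => //= r _; rewrite (_ : 1%E = 1%:E)// -EFinB !lee_fin; lra.
have UD : (unif R (\bigcup_J D J) <= (1/2)%:E)%E.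
  have h : unif R (D J) @[J --> \oo] --> unif R (\bigcup_J D J).
    apply: nondecreasing_cvg_mu => // n m nm; apply/subsetPset => x Dx j /= mj.
    by apply: Dx => /=; exact: leq_trans mj.
  rewrite -(cvg_lim _ h)//; apply: lime_le; first by apply: cvgP h.
  exact: nearW.
have : (unif R setT <= unif R N + unif R (\bigcup_J D J))%E.
  apply: le_trans (measureU2 _ _ _) => //.
  apply: le_measure; rewrite ?inE//; first exact: measurableU.
  move=> x _; have [Cx|nCx] := pselect (C x); last by left; apply: CN.
  by right; have [J hJ] := CA x Cx; exists J.
rewrite probability_setT N0 add0e => /le_trans /(_ UD); rewrite lee_fin; lra.
Qed.

(** If the energies were unbounded, [block_system] could be iterated from [M j] to [M j.+1]. With
    block j placed on digit j, each block has a partial sum of size at least 1 with probability at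
    least 1/2, which contradicts almost everywhere convergence. *)
Lemma frames_bounded : ae_convergent ->
  exists K, forall N s, frame a N s -> energy s <= K.
Proof.
move=> conv; apply: contrapT => nK.
have big K : exists N s, frame a N s /\ K <= energy s.
  apply: contrapT => h; apply: nK; exists K => N s fs; rewrite leNgt; apply/negP => Ks.
  by apply: h; exists N, s; split => //; exact: ltW.
have /choice[b bP] : forall M, exists b : nat * nat * (nat -> nat -> R),
    let: (N, Q, psi) := b in [/\ (M < N)%N, (0 < Q)%N,
    forall n m, (M <= n < N)%N -> (M <= m < N)%N ->
      \sum_(i < Q) psi n i * psi m i = (n == m)%:R * Q%:R,
    forall n, (M <= n < N)%N -> \sum_(i < Q) psi n i = 0 &
    (Q <= 2 * \sum_(i < Q) [exists k : 'I_N.+1, (1 <= `|\sum_(M <= n < k) a n * psi n i|)%R])%N].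
  move=> M; have [N [Q [psi h]]] := block_system a_gt0 M big.
  by exists (N, Q, psi).
pose M j := iter j (fun m => (b m).1.1) 0%N.
pose Q j := (b (M j)).1.2; pose psi j := (b (M j)).2.
have bM j : [/\ (M j < M j.+1)%N, (0 < Q j)%N,
    forall n m, (M j <= n < M j.+1)%N -> (M j <= m < M j.+1)%N ->
      \sum_(i < Q j) psi j n i * psi j m i = (n == m)%:R * (Q j)%:R,
    forall n, (M j <= n < M j.+1)%N -> \sum_(i < Q j) psi j n i = 0 &
    (Q j <= 2 * \sum_(i < Q j)
      [exists k : 'I_(M j.+1).+1, (1 <= `|\sum_(M j <= n < k) a n * psi j n i|)%R])%N].
  by have := bP (M j); rewrite /Q /psi /M iterS; case: (b _) => [[]].
have Mlt j : (M j < M j.+1)%N by have [] := bM j.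
have Q0 j : (0 < Q j)%N by have [] := bM j.
have jM j : (j <= M j)%N by elim: j => // j IH; exact: leq_ltn_trans (Mlt j).
have Mle i j : (i <= j)%N -> (M i <= M j)%N.
  by apply: (@homo_leq _ M leq) => //; [exact: leq_trans|move=> k; exact: ltnW].
have /choice[jb jbP] : forall n, exists j, (M j <= n < M j.+1)%N.
  elim=> [|n [j /andP[Mn nM]]]; first by exists 0%N; rewrite leqnn; exact: (Mlt 0%N).
  have [h|h] := ltnP n.+1 (M j.+1); first by exists j; rewrite h (leq_trans Mn).
  by exists j.+1; rewrite h (leq_ltn_trans nM).
have jb_uniq n j : (M j <= n < M j.+1)%N -> jb n = j.
  move=> /andP[h1 h2]; have /andP[h3 h4] := jbP n; apply/eqP; rewrite eqn_leq.
  by apply/andP; split; rewrite leqNgt; apply/negP => /Mle; lia.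
pose phi n := digit_rv Q (jb n) (psi (jb n) n).
have phiE n : phi n = digitf Q (jb n) (psi (jb n) n) :> (R -> R) by [].
have on : orthonormal_sequence phi.
  split=> [n|n k nk]; rewrite unlock.
    under eq_integral do rewrite expr2 phiE digitfM.
    rewrite integral_digitf//; have [_ _ h _ _] := bM (jb n).
    rewrite h ?jbP// eqxx mul1r divff// pnatr_eq0 -lt0n; exact: Q0.
  (* Within a block, orthogonality is the Gram relation of [psi]; across blocks it comes from
     distinct digits and zero means. *)
  have [e|ne] := eqVneq (jb n) (jb k).
    under eq_integral do rewrite !phiE -e digitfM.
    rewrite integral_digitf//; have [_ _ h _ _] := bM (jb n).
    by rewrite h ?jbP ?[in (_ <= k)%N]e ?e ?jbP// (negbTE (introN eqP nk)) !mul0r.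
  wlog lt : n k nk ne / (jb n < jb k)%N.
    move=> H; have [lt|lt|//] := ltngtP (jb n) (jb k); first exact: H.
      under eq_integral do rewrite mulrC.
      by apply: H => //; [exact/nesym|rewrite eq_sym].
    by move/eqP in ne.
  under eq_integral do rewrite !phiE.
  apply: integral_digitf2 => //; have [_ _ _ h _] := bM (jb k); exact/h/jbP.
pose G j i := [exists k : 'I_(M j.+1).+1, 1 <= `|\sum_(M j <= n < k) a n * psi j n i|].
pose g j := digitf Q j (fun i => (G j i)%:R : R).
pose A j : set (measurableTypeR R) := g j @^-1` [set 1].
have mA j : measurable (A j).
  by rewrite -[A j]setTI; apply: measurable_digitf => //; exact: measurable_set1.
have g01 j x : g j x = \1_(A j) x.
  rewrite indicE; have [|] := boolP (x \in A j); first by rewrite inE.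
  rewrite notin_setE /A /g /digitf /stepf /=; case: ifP => // _.
  by case: (G j _).
apply: (@not_ae_limsup A (fun x => cvgn (series (fun n => a n * phi n x))) mA) (conv _ _ _ _ on) => [j|x cx].
  have -> : unif R (A j) = (\int[unif R]_x (g j x)%:E)%E.
    under eq_integral do rewrite g01.
    by rewrite integral_indic// setIT.
  rewrite integral_digitf// lee_fin ler_pdivlMr ?ltr0n//.
  have [_ _ _ _] := bM j; rewrite -(ler_nat R) natrM natr_sum; lra.
have [l cl] := (cvg_ex _).1 cx.
(* Beyond [J] all partial sums are within 1/2 of the limit, so a block sum started at [M j >= J]
   stays below 1 and [A j] cannot hold. *)
have half : 0 < 1/2 :> R by lra.
move/cvgrPdist_lt: cl => /(_ _ half)[J _ hJ].
exists J => j Jj; rewrite /A /g /digitf /stepf /=.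
case: ifPn => [ux|_]; last by move/esym/eqP; rewrite oner_eq0.
case: (boolP (G _ _)) => [/existsP[k Gk] _|_ /esym/eqP]; last by rewrite oner_eq0.
have [kM|Mk] := ltnP k (M j).
  by move: Gk; rewrite big_geq ?normr0 ?ler10// ltnW.
have JM : (J <= M j)%N by exact: leq_trans (jM j).
have hk := hJ _ (leq_trans JM Mk : [set n | (J <= n)%N] k).
have hM := hJ _ (JM : [set n | (J <= n)%N] (M j)).
have := sub_series (fun n => a n * phi n x) (M j) k; rewrite Mk => e.
move: Gk; rewrite leNgt => /negP; apply.
rewrite (eq_big_nat _ _ (F2 := fun n => a n * phi n x)) -?e; last first.
  move=> n /andP[Mn nk]; have nj : (M j <= n < M j.+1)%N.
    by rewrite Mn (leq_trans nk)// -ltnS ltn_ord.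
  by rewrite phiE (jb_uniq _ _ nj) /digitf /stepf ux.
move: hk hM; rewrite /=; move: (series _ k) (series _ (M j)) => u v.
rewrite !ltr_norml => /andP[h1 h2] /andP[h3 h4]; apply/andP; split; lra.
Qed.

End divergence.

(** * Almost everywhere convergence *)

Section orthonormal_increments.
Variables (R : realType) (a : nat -> R) (d : measure_display) (Omega : measurableType d).
Variables (P : probability Omega R) (phi : nat -> {RV P >-> R}).
Hypothesis phi_on : orthonormal_sequence phi.

Let X n w : R := series (fun n => a n * phi n w) n.

Lemma measurable_partial n : measurable_fun setT (X n).
Proof.
rewrite (_ : X n = fun w => \sum_(i < n) a i * phi i w); last first.
  by apply/funext => w; rewrite /X /series/= big_mkord.
by apply: measurable_sum => i; apply: measurable_funM.
Qed.

Lemma integrable_prod i j : P.-integrable setT (fun w => (phi i w * phi j w)%:E).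
Proof.
have sq k : P.-integrable setT (fun w => (phi k w ^+ 2)%:E).
  apply/integrableP; split; first by apply/measurable_EFinP; exact: measurable_funX.
  have [h _] := phi_on; have := h k; rewrite unlock => e.
  under eq_integral do rewrite gee0_abs ?lee_fin ?sqr_ge0//.
  by rewrite e ltry.
apply: (le_integrable _ _ _ (integrableD _ (sq i) (sq j))) => //.
  by apply/measurable_EFinP; exact: measurable_funM.
move=> w _ /=; rewrite lee_fin [leRHS]ger0_norm ?addr_ge0 ?sqr_ge0//.
rewrite normrM -[X in _ <= X + _]real_normK ?num_real// -[X in _ <= _ + X]real_normK ?num_real//.
by move: `|phi i w| `|phi j w| => u v; have := sqr_ge0 (u - v); have := sqr_ge0 u; have := sqr_ge0 v; nra.
Qed.

Lemma integral_increment p n : (p <= n)%N ->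
  (\int[P]_w ((X n w - X p w) ^+ 2)%:E)%E = (psum a n - psum a p)%:E.
Proof.
move=> pn.
have XE w : X n w - X p w = \sum_(p <= i < n) a i * phi i w.
  by rewrite /X sub_series pn.
under eq_integral do rewrite XE expr2 big_distrlr/= -sumEFin.
have ij i j : P.-integrable setT (fun w => (a i * phi i w * (a j * phi j w))%:E).
  under eq_fun do rewrite mulrACA EFinM.
  by apply: integrableZl => //; exact: integrable_prod.
rewrite integral_sum//=; last first.
  move=> i; under eq_fun do rewrite -sumEFin.
  by apply: integrable_sum.
have e i j : (\int[P]_w (a i * phi i w * (a j * phi j w))%:E)%E = ((i == j)%:R * a i ^+ 2)%:E.
  under eq_integral do rewrite mulrACA EFinM.
  rewrite integralZl//; last exact: integrable_prod.
  have [h1 h2] := phi_on; have [->|/eqP ne] := eqVneq i j.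
    have -> : (\int[P]_w (phi j w * phi j w)%:E)%E = 1%E.
      by rewrite -(h1 j) unlock; apply: eq_integral => w _; rewrite expr2.
    by rewrite mule1 mul1r expr2.
  by have := h2 i j ne; rewrite unlock => ->; rewrite mule0 mul0r.
have -> : psum a n - psum a p = \sum_(p <= i < n) a i ^+ 2.
  by rewrite /psum -/(series _ n) -/(series _ p) sub_series pn.
rewrite -sumEFin !big_seq; apply: eq_bigr => i; rewrite mem_index_iota => /andP[pi i_n].
under eq_integral do rewrite -sumEFin.
rewrite integral_sum//= (eq_bigr _ (fun j _ => e i j)) sumEFin (bigD1_seq i) ?iota_uniq//=; last first.
  by rewrite mem_index_iota pi.
rewrite eqxx mul1r big1 ?addr0// => j ji.
by rewrite eq_sym (negbTE ji) mul0r.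
Qed.

Lemma integral_increment_abs p n :
  (\int[P]_w ((X n w - X p w) ^+ 2)%:E)%E = `|psum a n - psum a p|%:E.
Proof.
have [pn|/ltnW np] := leqP p n.
  by rewrite integral_increment// ger0_norm// subr_ge0 psum_nd.
under eq_integral do rewrite -opprB sqrrN.
by rewrite integral_increment// distrC ger0_norm// subr_ge0 psum_nd.
Qed.

Section chaining.
Variable l : R.
Hypothesis psum_lt : forall n, psum a n < l.

Let x n := psum a n / l.
Let l0 : 0 < l. Proof. by rewrite -(psum0 a). Qed.
Let x0 n : 0 <= x n. Proof. exact: x_ge0. Qed.

Lemma cell_dist k n p : cell x k n = cell x k p -> `|psum a n - psum a p| <= l * (2^-1 ^+ k) ^+ 2.
Proof.
move=> e; have /andP[h1 h2] := cell_itv x0 k n; have := cell_itv x0 k p.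
rewrite -e => /andP[h3 h4]; rewrite -[(cell x k n).+1%:R]natr1 in h2 h4.
have : `|4 ^+ k * x n - 4 ^+ k * x p| <= 1.
  move: h1 h2 h3 h4; move: (4 ^+ k * x n) (4 ^+ k * x p) => u v h1 h2 h3 h4.
  by rewrite ler_norml; apply/andP; split; lra.
rewrite -mulrBr -mulrBl !normrM.
have p4 : 0 < 4 ^+ k :> R by rewrite exprn_gt0.
rewrite (gtr0_norm p4) (gtr0_norm (_ : 0 < l^-1)) ?invr_gt0//.
rewrite mulrA ler_pdivrMr// mul1r mulrC -ler_pdivlMr// => h.
by rewrite exprAC (_ : 2^-1 ^+ 2 = 4^-1) ?exprVn//; field.
Qed.

Definition dominated N k i p c (Z : Omega -> R) :=
  [/\ measurable_fun setT Z, forall w, 0 <= Z w,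
      forall n w, (n <= N)%N -> cell x k n = i -> (X n w - X p w) ^+ 2 <= Z w &
      (\int[P]_w (Z w)%:E <= (4 * l * c ^+ 2)%:E)%E].

(** For n in child j with representative q, split [X n - X p] into [X q - X p] and [X n - X q]. Let
    b be [2^-1 ^+ k] and bt the root of the sum of the squared values of the children. The weights
    [1 + bt / b] and [1 + b / bt] in the bound for the square of a sum give, after adding over the
    four children, exactly [4 * l * (b + bt) ^+ 2]; the 4 counts the children in the first term. *)
Lemma chaining N L : (forall n m, (n <= N)%N -> (m <= N)%N -> cell x L n = cell x L m -> n = m) ->
  forall e k i p, (e + k)%N = L -> cell x k p = i ->
  exists Z, dominated N k i p (treeV x e k i) Z.
Proof.
move=> sep.
have lV c : 0 <= 4 * l * c ^+ 2 by rewrite mulr_ge0 ?sqr_ge0// mulr_ge0// ltW.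
elim=> [|e IH] k i p.
  rewrite add0n => -> pi; have Li : inhab x L i by rewrite -pi inhab_cell.
  (* At level [L] a cell contains at most one index up to [N], so a single squared increment
     dominates. *)
  have [[n nN ni]|no] := pselect (exists2 n, (n <= N)%N & cell x L n = i).
    exists (fun w => (X n w - X p w) ^+ 2); split.
    - by apply: measurable_funX; apply: measurable_funB; exact: measurable_partial.
    - by move=> w; exact: sqr_ge0.
    - by move=> m w mN mi; rewrite (sep m n)// ni.
    - rewrite integral_increment_abs lee_fin treeV0//.
      have := cell_dist (etrans ni (esym pi)); have := mulr_ge0 (ltW l0) (sqr_ge0 (2^-1 ^+ L)); lra.
  exists (fun=> 0); split => //.
  - by move=> n w nN ni; exfalso; apply: no; exists n.
  - by rewrite integral0 lee_fin.
rewrite addSnnS => eL pi.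
have ki : inhab x k i by rewrite -pi inhab_cell.
pose V (j : 'I_4) := treeV x e k.+1 (4 * i + j).
have /choice[A hA] : forall j : 'I_4, exists AZ : (Omega -> R) * (Omega -> R),
   [/\ measurable_fun setT AZ.1, measurable_fun setT AZ.2, forall w, 0 <= AZ.1 w,
     forall w, 0 <= AZ.2 w &
     [/\ forall n w, (n <= N)%N -> cell x k.+1 n = (4 * i + j)%N -> 
        exists b c, [/\ X n w - X p w = b + c, b ^+ 2 <= AZ.1 w & c ^+ 2 <= AZ.2 w],
     (\int[P]_w (AZ.1 w)%:E <= (l * (2^-1 ^+ k) ^+ 2)%:E)%E &
     (\int[P]_w (AZ.2 w)%:E <= (4 * l * V j ^+ 2)%:E)%E]].
  move=> j; have lk : 0 <= l * (2^-1 ^+ k) ^+ 2 by rewrite mulr_ge0 ?sqr_ge0// ltW.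
  have [/inhabP[q qj]|h] := boolP (inhab x k.+1 (4 * i + j)); last first.
    exists (fun=> 0, fun=> 0); split=> //=; split; rewrite ?integral0 ?lee_fin//=.
    by move=> n w nN nj; move: h; rewrite -nj inhab_cell.
  have [Z [mZ Z0 ZX ZV]] := IH k.+1 (4 * i + j)%N q eL qj.
  exists (fun w => (X q w - X p w) ^+ 2, Z); split => //=.
  - by apply: measurable_funX; apply: measurable_funB; exact: measurable_partial.
  - by move=> w; exact: sqr_ge0.
  split=> //.
  - move=> n w nN nj; exists (X q w - X p w), (X n w - X q w); split=> //; first ring.
    exact: ZX.
  - rewrite integral_increment_abs lee_fin; apply: cell_dist.
    by rewrite pi; exact: (cellS_in x0 (ltn_ord j) qj).
have mA1 j : measurable_fun setT (A j).1 by have [] := hA j.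
have mA2 j : measurable_fun setT (A j).2 by have [] := hA j.
have A10 j w : 0 <= (A j).1 w by have [] := hA j.
have A20 j w : 0 <= (A j).2 w by have [] := hA j.
have AX j n w : (n <= N)%N -> cell x k.+1 n = (4 * i + val j)%N ->
  exists b c, [/\ X n w - X p w = b + c, b ^+ 2 <= (A j).1 w & c ^+ 2 <= (A j).2 w].
  by have [_ _ _ _ [h _ _]] := hA j; exact: h.
have A1V j : (\int[P]_w ((A j).1 w)%:E <= (l * (2^-1 ^+ k) ^+ 2)%:E)%E.
  by have [_ _ _ _ []] := hA j.
have A2V j : (\int[P]_w ((A j).2 w)%:E <= (4 * l * V j ^+ 2)%:E)%E.
  by have [_ _ _ _ []] := hA j.
rewrite treeVS//; set S := \sum_(j < 4) _; set b := 2^-1 ^+ k.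
have b0 : 0 < b by rewrite exprn_gt0.
have S0 : 0 < S.
  have [j ej _] := cell_child x0 k p; rewrite /S (bigD1 j)//= ltr_wpDr ?sumr_ge0//.
    by move=> q _; exact: sqr_ge0.
  by rewrite exprn_gt0// treeV_gt0// -pi -ej inhab_cell.
set bt := Num.sqrt S; have bt0 : 0 < bt by rewrite sqrtr_gt0.
have btS : bt ^+ 2 = S by rewrite sqr_sqrtr// ltW.
have cA : 0 <= 1 + bt / b by rewrite addr_ge0// divr_ge0// ltW.
have cB : 0 <= 1 + b / bt by rewrite addr_ge0// divr_ge0// ltW.
exists (fun w => \sum_j ((1 + bt / b) * (A j).1 w + (1 + b / bt) * (A j).2 w)); split.
- apply: measurable_sum => j; apply: measurable_funD; exact: measurable_funM.
- by move=> w; apply: sumr_ge0 => j _; rewrite addr_ge0// mulr_ge0.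
- move=> n w nN ni; have [j ej _] := cell_child x0 k n; rewrite ni in ej.
  have [u [v [-> hu hv]]] := AX j n w nN ej.
  rewrite (bigD1 j)//= ler_wpDr//.
    by apply: sumr_ge0 => q _; rewrite addr_ge0// mulr_ge0.
  apply: (@le_trans _ _ ((1 + bt / b) * u ^+ 2 + (1 + b / bt) * v ^+ 2)); last first.
    by apply: lerD; exact: ler_wpM2l.
  rewrite -subr_ge0.
  have -> : (1 + bt / b) * u ^+ 2 + (1 + b / bt) * v ^+ 2 - (u + v) ^+ 2 =
     (bt * u - b * v) ^+ 2 / (b * bt) by field; rewrite !gt_eqF.
  by rewrite divr_ge0 ?sqr_ge0// mulr_ge0// ltW.
- under eq_integral do rewrite -sumEFin.
  rewrite ge0_integral_sum//=; last 2 first.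
  + by move=> j; apply/measurable_EFinP; apply: measurable_funD; exact: measurable_funM.
  + by move=> j w _; rewrite lee_fin addr_ge0// mulr_ge0.
  have h j : (\int[P]_w ((1 + bt / b) * (A j).1 w + (1 + b / bt) * (A j).2 w)%:E <=
      ((1 + bt / b) * (l * b ^+ 2) + (1 + b / bt) * (4 * l * V j ^+ 2))%:E)%E.
    under eq_integral do rewrite EFinD !EFinM.
    rewrite ge0_integralD//=; last 4 first.
    + by move=> w _; rewrite -EFinM lee_fin mulr_ge0.
    + by under eq_fun do rewrite -EFinM; apply/measurable_EFinP; exact: measurable_funM.
    + by move=> w _; rewrite -EFinM lee_fin mulr_ge0.
    + by under eq_fun do rewrite -EFinM; apply/measurable_EFinP; exact: measurable_funM.
    rewrite !ge0_integralZl//=; try (exact/measurable_EFinP); try (by move=> w _; rewrite lee_fin).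
    rewrite [leRHS]EFinD; apply: leeD; rewrite [leRHS]EFinM.
      by apply: lee_wpmul2l; rewrite ?lee_fin.
    by apply: lee_wpmul2l; rewrite ?lee_fin.
  apply: le_trans (lee_sum _ (fun j _ => h j)) _.
  rewrite sumEFin lee_fin big_split/= sumr_const card_ord -!mulr_sumr -/V.
  have -> : \sum_j V j ^+ 2 = bt ^+ 2 by rewrite btS.
  rewrite le_eqVlt; apply/orP; left; apply/eqP.
  by rewrite -mulr_natl; field; rewrite !gt_eqF.
Qed.

End chaining.
End orthonormal_increments.

(** * Smallness of the tree functional near the limit point *)

Section last_cell.
Variables (R : realType) (x : nat -> R) (B : R).
Hypothesis x_ge0 : forall n, 0 <= x n.
Hypothesis x_lt1 : forall n, x n < 1.
Hypothesis VB : forall d, treeV x d 0 0 <= B.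

(* The cells [1 - 4^-k, 1), which contain a tail of the sequence x. *)
Definition last_index k : nat := (4 ^ k).-1.

Lemma last_child k : (4 * last_index k + 3)%N = last_index k.+1.
Proof.
rewrite /last_index expnS; have : (0 < 4 ^ k)%N by rewrite expn_gt0.
by case: (4 ^ k)%N => // m _; lia.
Qed.

Let v k := Vlim x k (last_index k).

Lemma Vlim_child k i (j : 'I_4) : Vlim x k.+1 (4 * i + j) <= Vlim x k i.
Proof.
apply: (Vlim_le x_ge0 x_lt1 VB) => d; apply: le_trans (treeV_child x_ge0 _ _ _ _) _.
exact: treeV_le_lim x_lt1 VB _ _ _.
Qed.

Lemma v_nonincr : {homo v : m k / (m <= k)%N >-> k <= m}.
Proof.
apply: homo_leq => [y|y w z h1 h2|k]; [exact: lexx|exact: le_trans h1|].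
by rewrite /v -last_child; exact: (@Vlim_child _ _ (@Ordinal 4 3 isT)).
Qed.

(** By [VlimS], the squares of the three siblings of the next last cell add up to at most
    [v k ^+ 2 - v k.+1 ^+ 2]. With [rho] and [r] the roots at levels [k.+1] and [k], the induction
    step is [(r ^+ 2 - rho ^+ 2) + (b + rho) ^+ 2 <= (b + r) ^+ 2], true because [rho <= r]. *)
Lemma treeV_last s : (forall k, s <= v k ^+ 2) -> forall d k,
  treeV x d k (last_index k) <= 2 * 2^-1 ^+ k + Num.sqrt (v k ^+ 2 - s).
Proof.
move=> sv; have b0 k : 0 < 2^-1 ^+ k :> R by rewrite exprn_gt0.
have r0 k : 0 <= Num.sqrt (v k ^+ 2 - s) by exact: sqrtr_ge0.
elim=> [|d IH] k; have [ki|/treeV_empty ->] := boolP (inhab x k (last_index k)); last first.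
- by rewrite addr_ge0// mulr_ge0// ltW.
- rewrite treeVS//; set b := 2^-1 ^+ k.
  have hv := VlimS x_ge0 x_lt1 VB ki; rewrite -/(v k) -/b in hv.
  rewrite big_ord_recr/= last_child in hv; rewrite big_ord_recr/= last_child.
  set o := \sum_(j < 3) _ in hv; set o' := \sum_(j < 3) _.
  have oo : o' <= o.
    apply: ler_sum => j _; rewrite ler_sqr ?nnegrE ?treeV_ge0//; last first.
      exact: Vlim_ge0 x_lt1 VB _ _.
    exact: treeV_le_lim x_lt1 VB _ _ _.
  have o0 : 0 <= o by apply: sumr_ge0 => j _; exact: sqr_ge0.
  have := IH k.+1; set rho := Num.sqrt _ => hV.
  have e2 : 2 * 2^-1 ^+ k.+1 = b by rewrite exprS mulrA divff ?mul1r.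
  rewrite e2 in hV.
  have rho0 : 0 <= rho by exact: sqrtr_ge0.
  have rho2 : rho ^+ 2 = v k.+1 ^+ 2 - s by rewrite sqr_sqrtr// subr_ge0.
  have vv : o + v k.+1 ^+ 2 <= v k ^+ 2.
    have h0 : 0 <= o + v k.+1 ^+ 2 by rewrite addr_ge0 ?sqr_ge0.
    rewrite -(sqr_sqrtr h0) ler_sqr ?nnegrE ?sqrtr_ge0//; last exact: Vlim_ge0 x_lt1 VB _ _.
    by apply: le_trans hv; rewrite lerDr ltW// b0.
  rewrite mulrDl mul1r -addrA lerD2l.
  set r := Num.sqrt (v k ^+ 2 - s).
  have r2 : r ^+ 2 = v k ^+ 2 - s by rewrite sqr_sqrtr// subr_ge0.
  have bb : 0 < b by exact: b0.
  have rr : 0 <= r by exact: r0.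
  rewrite -[leRHS]ger0_norm ?addr_ge0 ?(ltW bb)// -sqrtr_sqr ler_wsqrtr//.
  have hV2 : treeV x d k.+1 (last_index k.+1) ^+ 2 <= (b + rho) ^+ 2.
    by rewrite ler_sqr ?nnegrE ?treeV_ge0 ?addr_ge0// ltW.
  have : rho <= r by rewrite -ler_sqr ?nnegrE// rho2 r2; lra.
  move: (treeV _ _ _ _ ^+ 2) hV2 => T hV2 rhor; nra.
- by rewrite addr_ge0// mulr_ge0// ltW.
- by rewrite treeV0//; have := r0 k; have := b0 k; lra.
Qed.

(** Taking for [s] the infimum of the [v k ^+ 2] makes both terms of [treeV_last] at most [e / 2] at
    a late level; [K1] handles the first through [4 / e < K1 <= 2 ^+ K1]. *)
Lemma treeV_last_small e : 0 < e -> exists K, forall d, treeV x d K (last_index K) <= e.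
Proof.
move=> e0; pose S := range (fun k => v k ^+ 2).
have S0 : lbound S 0 by move=> _ [k _ <-]; exact: sqr_ge0.
have Si : has_inf S by split; [exists (v 0 ^+ 2); exists 0%N|exists 0].
have e2 : 0 < (e / 2) ^+ 2 by rewrite exprn_gt0// divr_gt0.
have [_ [K0 _ <-] hK0] := inf_adherent e2 Si.
have sv k : inf S <= v k ^+ 2 by apply: ge_inf; [exists 0|exists k].
pose K1 := (Num.truncn (4 / e)).+1.
exists (maxn K0 K1) => d; apply: le_trans (treeV_last sv _ _) _.
set K := maxn K0 K1.
have h1 : 2 * 2^-1 ^+ K <= e / 2.
  have : 4 / e <= 2 ^+ K.
    have h : 4 / e < K1%:R by exact: truncnS_gt.
    apply: le_trans (ltW h) _; rewrite -natrX ler_nat.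
    by apply: leq_trans (leq_maxr K0 K1) _; exact/ltnW/ltn_expl.
  rewrite ler_pdivrMr// => h; rewrite exprVn ler_pdivrMr ?exprn_gt0//.
  by move: (2 ^+ K) h => p h; lra.
have h2 : Num.sqrt (v K ^+ 2 - inf S) <= e / 2.
  rewrite -[leRHS]ger0_norm ?divr_ge0 ?(ltW e0)// -sqrtr_sqr ler_wsqrtr//.
  have : v K ^+ 2 <= v K0 ^+ 2.
    rewrite ler_sqr ?nnegrE; [|exact: Vlim_ge0 x_lt1 VB _ _|exact: Vlim_ge0 x_lt1 VB _ _].
    by apply: v_nonincr; exact: leq_maxl.
  lra.
lra.
Qed.

End last_cell.

(** * From maximal inequalities to almost everywhere convergence *)

Section convergence.
Variables (R : realType) (a : nat -> R).
Hypothesis a_gt0 : forall n, 0 < a n.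

(** Chebyshev's inequality, uniform in [N], makes [U e M] as small in measure as desired. The sets
    [D e], where the oscillation reaches [e] after every [M], are therefore null, and off the union
    of those with [e = m.+1%:R^-1] the sequence is Cauchy. *)
Lemma ae_cvg_of_maximal (d : measure_display) (Omega : measurableType d)
    (P : probability Omega R) (X : nat -> Omega -> R) :
  (forall n, measurable_fun setT (X n)) ->
  (forall e : R, 0 < e -> exists M, forall N, exists Z : Omega -> R,
    [/\ measurable_fun setT Z, forall w, 0 <= Z w,
        forall n w, (M <= n <= N)%N -> (X n w - X M w) ^+ 2 <= Z w &
        (\int[P]_w (Z w)%:E <= e%:E)%E]) ->
  {ae P, forall w, cvgn (fun n => X n w)}.
Proof.
move=> mX hX.
pose S (e : R) M N := [set w | exists2 n, (M <= n <= N)%N & e <= `|X n w - X M w|].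
pose U e M := \bigcup_N S e M N.
have mS e M N : measurable (S e M N).
  rewrite (_ : S e M N = \bigcup_(n in [set n | (M <= n <= N)%N]) [set w | e <= `|X n w - X M w|]); last first.
    apply/seteqP; split=> w; first by move=> [n h1 h2]; exists n.
    by move=> [n /= h1 h2]; exists n.
  apply: bigcup_measurable => n _.
  rewrite (_ : [set w | _] = (fun w => `|X n w - X M w|) @^-1` `[e, +oo[); last first.
    by apply/seteqP; split=> w /=; rewrite in_itv/= andbT.
  rewrite -[X in measurable X]setTI.
  apply: (measurableT_comp (@normr_measurable _ setT)) => //.
  exact: measurable_funB.
have mU e M : measurable (U e M) by exact: bigcup_measurable.
have PS e dl : 0 < e -> 0 < dl -> exists M, (P (U e M) <= dl%:E)%E.
  move=> e0 dl0; have [|M hM] := hX (e ^+ 2 * dl); first by rewrite mulr_gt0// exprn_gt0.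
  exists M; have h : P (S e M N) @[N --> \oo] --> P (U e M).
    apply: nondecreasing_cvg_mu => [N||m n mn]; [exact: mS|exact: mU|].
    apply/subsetPset => w [k /andP[h1 h2] h3].
    by exists k => //; rewrite h1 (leq_trans h2).
  rewrite -(cvg_lim _ h)//; apply: lime_le; first by apply: cvgP h.
  apply: nearW => N; have [Z [mZ Z0 ZX ZV]] := hM N.
  have : (\int[P]_w (e ^+ 2 * \1_(S e M N) w)%:E <= \int[P]_w (Z w)%:E)%E.
    apply: ge0_le_integral => //.
    - by move=> w _; rewrite lee_fin mulr_ge0 ?sqr_ge0.
    - by apply/measurable_EFinP; apply: measurable_funM => //; exact: measurable_indic.
    - exact/measurable_EFinP.
    move=> w _; rewrite lee_fin indicE; have [wS|_] := boolP (w \in _); last by rewrite mulr0.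
    rewrite mulr1; move: wS; rewrite inE => -[n nMN en]; apply: le_trans (ZX n w nMN).
    by rewrite -[leRHS]real_normK ?num_real// ler_sqr ?nnegrE// ltW.
  under eq_integral do rewrite EFinM.
  rewrite ge0_integralZl//=; last 2 first.
  - by apply/measurable_EFinP; exact: measurable_indic.
  - by rewrite lee_fin sqr_ge0.
  rewrite integral_indic// setIT => h1; have := le_trans h1 ZV.
  by rewrite (EFinM (e ^+ 2) dl) lee_pmul2l// lte_fin exprn_gt0.
pose D e := \bigcap_M U e M.
have mD e : measurable (D e) by apply: bigcap_measurable => //; exists 0%N.
have PD e : 0 < e -> P (D e) = 0.
  move=> e0; apply/le_anti/andP; split; last exact: measure_ge0.
  apply/lee_addgt0Pr => dl dl0; rewrite add0e.
  have [M hM] := PS e dl e0 dl0; apply: le_trans hM.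
  by apply: le_measure; rewrite ?inE// => w; apply.
have nD : P.-negligible (\bigcup_m D m.+1%:R^-1).
  by apply: negligible_bigcup => m; exists (D m.+1%:R^-1); split => //; apply: PD; rewrite invr_gt0.
apply: (negligibleS _ nD).
move=> w /=; apply: contra_notP => hw.
apply/cauchy_cvgP/cauchy_exP => e e0 /=.
pose m := Num.truncn e^-1.
have me : m.+1%:R^-1 < e.
  by rewrite invf_plt ?posrE// truncnS_gt.
have [M hM] : exists M, ~ U m.+1%:R^-1 M w.
  apply: contrapT => h; apply: hw; exists m => // M _; apply: contrapT => hU.
  by apply: h; exists M.
exists (X M w); exists M => // n /= Mn.
rewrite /ball/= distrC; apply: lt_trans me.
rewrite ltNge; apply/negP => h; apply: hM; exists n => //; exists n => //.
by rewrite Mn leqnn.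
Qed.

Section bounded_tree.
Variables (l B : R).
Hypothesis psum_lt : forall n, psum a n < l.
Hypothesis psum_sup : forall y, y < l -> exists n, y < psum a n.

Let x n := psum a n / l.
Let l0 : 0 < l. Proof. by rewrite -(psum0 a). Qed.
Let x0 n : 0 <= x n. Proof. exact: x_ge0. Qed.

(** The finitely many gaps [x n.+1 - x n] are positive, so at a fine enough scale each of them is at
    least one cell long. *)
Lemma cells_separated N : exists L0, forall L, (L0 <= L)%N ->
  forall n m, (n <= N)%N -> (m <= N)%N -> cell x L n = cell x L m -> n = m.
Proof.
have xmono n m : (n < m)%N -> x n.+1 <= x m.
  by move=> nm; rewrite ler_pM2r ?invr_gt0// psum_nd.
have [L0 hL0] : exists L0 : nat, forall n, (n <= N)%N -> 1 <= 4 ^+ L0 * (x n.+1 - x n).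
  pose c n : nat := (Num.truncn (x n.+1 - x n)^-1).+1.
  exists (\max_(n < N.+1) c n) => n nN.
  have xx : 0 < x n.+1 - x n.
    by rewrite /x psumS -mulrBl addrAC subrr add0r divr_gt0// exprn_gt0.
  rewrite -ler_pdivrMr// mul1r; apply: (@le_trans _ _ (c n)%:R); first exact/ltW/truncnS_gt.
  rewrite -natrX ler_nat; have cm : (c n <= \max_(i < N.+1) c i)%N.
    exact: (@leq_bigmax _ (fun i : 'I_N.+1 => c i) (Ordinal (nN : (n < N.+1)%N))).
  apply: leq_trans cm _.
  exact/ltnW/ltn_expl.
exists L0 => L L0L.
have key n m : (n <= N)%N -> (n < m)%N -> cell x L n <> cell x L m.
  move=> nN nm e; have /andP[h1 h2] := cell_itv x0 L n; have /andP[h3 h4] := cell_itv x0 L m.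
  rewrite -e in h3 h4; rewrite -[(cell x L n).+1%:R]natr1 in h2 h4.
  have h5 := hL0 n nN; have h6 := xmono _ _ nm.
  have h7 : (4 ^+ L0 : R) <= 4 ^+ L by rewrite ler_eXn2l// ltr1n.
  have p4 : 0 < 4 ^+ L0 :> R by rewrite exprn_gt0.
  have h8 : 4 ^+ L0 * (x n.+1 - x n) <= 4 ^+ L * (x m - x n).
    by apply: ler_pM; rewrite ?(ltW p4)//; nra.
  clear e; move: h1 h2 h3 h4 h8 h5; rewrite !mulrBr; move: (4 ^+ L * x n) (4 ^+ L * x m) ((cell x L n)%:R : R) => u v w *; lra.
move=> n m nN mN e; have [nm|mn|//] := ltngtP n m.
- by have := key n m nN nm e.
- by have := key m n mN mn (esym e).
Qed.

Lemma cell_last K : exists M, cell x K M = last_index K /\ forall n, (M <= n)%N -> cell x K n = last_index K.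
Proof.
have p4 : 0 < 4 ^+ K :> R by rewrite exprn_gt0.
have eK : (last_index K)%:R = 4 ^+ K - 1 :> R.
  by rewrite /last_index -natrX -[in RHS](prednK (expn_gt0 4 K)) -natr1 addrK.
have yl : l * (1 - (4 ^+ K)^-1) < l.
  by rewrite -[ltRHS]mulr1 ltr_pM2l// ltrBlDr ltrDl invr_gt0.
have [M hM] := psum_sup yl.
have h n : (M <= n)%N -> cell x K n = last_index K.
  move=> Mn; apply/(cell_eqP x0); rewrite -[(last_index K).+1%:R]natr1 eK; apply/andP; split.
    have : psum a M <= psum a n by exact: psum_nd.
    move=> /(lt_le_trans hM) h; rewrite /x mulrA ler_pdivlMr//.
    have := ltW h; rewrite -(ler_pM2l p4) mulrCA mulrBr mulr1 divff ?gt_eqF// => h'.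
    by rewrite [leLHS]mulrC.
  by rewrite subrK -[ltRHS]mulr1 ltr_pM2l//; exact: x_lt1.
by exists M; split => //; exact: h.
Qed.

(** Chaining is applied inside a last cell: it contains a tail of the sequence, and its tree
    functional is small at every depth. *)
Lemma treeV_ae_convergent : (forall d, treeV x d 0 0 <= B) -> ae_convergent a.
Proof.
move=> VB d Omega P phi on.
pose X n w : R := series (fun n => a n * phi n w) n.
apply: (@ae_cvg_of_maximal _ _ P X) => [n|e e0]; first exact: measurable_partial.
have x1 n : x n < 1 by exact: x_lt1.
(* Chosen so that the chaining bound [4 * l * e1 ^+ 2] equals [e]. *)
pose e1 := Num.sqrt (e / (4 * l)).
have l4 : 0 < 4 * l by rewrite mulr_gt0.
have e10 : 0 < e1 by rewrite sqrtr_gt0 divr_gt0.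
have [K hK] := treeV_last_small x0 x1 VB e10.
have [M [cM hM]] := cell_last K.
exists M => N; have [L0 hL0] := cells_separated N.
have sep := hL0 (maxn L0 K) (leq_maxl _ _).
have [Z [mZ Z0 ZX ZV]] := chaining on psum_lt sep (e := maxn L0 K - K) (subnK (leq_maxr _ _)) cM.
exists Z; split => // [n w /andP[Mn nN]|]; first exact: ZX (hM n Mn).
apply: le_trans ZV _; rewrite lee_fin -ler_pdivlMl// mulrC.
rewrite -(sqr_sqrtr (ltW (divr_gt0 e0 l4))) ler_sqr ?nnegrE ?(ltW e10)//.
exact: treeV_ge0.
Qed.

End bounded_tree.
End convergence.

(** * Bounds from a majorizing measure *)

Section measure_upper_bound.
Variables (R : realType) (x : nat -> R).
Hypothesis x_ge0 : forall n, 0 <= x n.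
Hypothesis x_lt1 : forall n, x n < 1.

Fixpoint tsum (f : nat -> nat -> R) d k i : R :=
  f k i + if d is d'.+1 then \sum_(j < 4) tsum f d' k.+1 (4 * i + j) else 0.

Lemma tsumE f d k i :
  tsum f d k i = \sum_(l < d.+1) \sum_(r < 4 ^ l) f (k + l)%N (4 ^ l * i + r)%N.
Proof.
elim: d k i => [|d IH] k i.
  by rewrite /= big_ord1 expn0 big_ord1 /= mul1n !addn0 addr0.
rewrite [LHS]/= [RHS]big_ord_recl expn0 big_ord1 /= mul1n !addn0; congr (_ + _).
under eq_bigr do rewrite IH.
rewrite exchange_big/=; apply: eq_bigr => l _; rewrite /bump/= add1n addSnnS expnS.
pose F r := f (k + l.+1)%N (4 * 4 ^ l * i + r)%N.
rewrite -(big_mkord xpredT F) big_nat_mul big_mkord; apply: eq_bigr => j _.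
rewrite mulSn -{1}[(j * _)%N]add0n big_addn addnK big_mkord; apply: eq_bigr => r _.
by rewrite /F; congr (f _ _); lia.
Qed.

Lemma cell_lt k n : (cell x k n < 4 ^ k)%N.
Proof.
have /andP[h _] := cell_itv x_ge0 k n; rewrite -(ltr_nat R) natrX.
by apply: le_lt_trans h _; rewrite gtr_pMr ?exprn_gt0.
Qed.

Lemma sqrt_half k (y : R) : 0 < y ->
  (2^-1 ^+ k / Num.sqrt y) * (2^-1 ^+ k * Num.sqrt y) = (2^-1 ^+ k) ^+ 2.
Proof.
move=> y0; have : Num.sqrt y != 0 by rewrite gt_eqF// sqrtr_gt0.
by move: (Num.sqrt y) (2^-1 ^+ k) => s b s0; field.
Qed.

Section mass.
Variable M : nat -> nat -> R.
Hypothesis M_ge0 : forall k i, 0 <= M k i.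
Hypothesis M_empty : forall k i, ~~ inhab x k i -> M k i = 0.
Hypothesis M_child : forall k i, \sum_(j < 4) M k.+1 (4 * i + j) <= M k i.

Lemma sum4_cauchy (u v : 'I_4 -> R) : (forall j, 0 <= v j) -> (forall j, 0 <= u j) ->
  \sum_j Num.sqrt (u j) * v j <= Num.sqrt (\sum_j u j) * Num.sqrt (\sum_j v j ^+ 2).
Proof.
move=> v0 u0; rewrite -sqrtrM ?sumr_ge0//.
have s0 : 0 <= \sum_j Num.sqrt (u j) * v j.
  by apply: sumr_ge0 => j _; rewrite mulr_ge0 ?sqrtr_ge0.
rewrite -[leLHS]ger0_norm// -sqrtr_sqr ler_wsqrtr//.
have e j : u j = Num.sqrt (u j) ^+ 2 by rewrite sqr_sqrtr.
under [X in _ <= X * _]eq_bigr do rewrite e.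
have cs (a b c d e1 f g h : R) : (a * e1 + b * f + c * g + d * h) ^+ 2 <=
    (a ^+ 2 + b ^+ 2 + c ^+ 2 + d ^+ 2) * (e1 ^+ 2 + f ^+ 2 + g ^+ 2 + h ^+ 2).
  have := sqr_ge0 (a * f - b * e1); have := sqr_ge0 (a * g - c * e1).
  have := sqr_ge0 (a * h - d * e1); have := sqr_ge0 (b * g - c * f).
  have := sqr_ge0 (b * h - d * f); have := sqr_ge0 (c * h - d * g); nra.
by rewrite !sum4E; exact: cs.
Qed.

(** The upper-bound half of the extremal property of [treeV]: at each level, Cauchy-Schwarz over the
    four children, whose masses add up to at most that of the parent. *)
Lemma tsum_le_treeV d k i :
  tsum (fun k i => 2^-1 ^+ k * Num.sqrt (M k i)) d k i <= Num.sqrt (M k i) * treeV x d k i.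
Proof.
elim: d k i => [|d IH] k i; have [ki|h] := boolP (inhab x k i); last 2 first.
- rewrite treeVS//= mulrDr [_ * 2^-1 ^+ k]mulrC lerD2l.
  apply: (@le_trans _ _ (\sum_(j < 4) Num.sqrt (M k.+1 (4 * i + j)) * treeV x d k.+1 (4 * i + j))).
    by apply: ler_sum => j _; exact: IH.
  apply: le_trans (@sum4_cauchy (fun j => M k.+1 (4 * i + j)) _ _ _) _ => [j|j|].
  - exact: treeV_ge0.
  - exact: M_ge0.
  by rewrite ler_wpM2r ?sqrtr_ge0// ler_wsqrtr.
- rewrite treeV_empty// mulr0 /= M_empty// sqrtr0 mulr0 add0r; apply: sumr_le0 => j _.
  apply: le_trans (IH _ _) _; rewrite treeV_empty ?mulr0//.
  by apply: contra h; exact: inhab_parent.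
- by rewrite treeV0//= addr0 mulrC.
- by rewrite /= M_empty// sqrtr0 mulr0 addr0 mul0r.
Qed.

(* The cell and its two neighbours: they cover every ball of radius 4^-k whose
   centre lies in the cell. *)
Definition fat k i : R := (if i is i'.+1 then M k i' else 0) + M k i + M k i.+1.

Lemma fat_ge0 k i : 0 <= fat k i.
Proof. by rewrite /fat !addr_ge0//; case: i. Qed.

Lemma sqrtD_le (y z : R) : 0 <= y -> 0 <= z -> Num.sqrt (y + z) <= Num.sqrt y + Num.sqrt z.
Proof.
move=> y0 z0; rewrite -[leRHS]ger0_norm ?addr_ge0 ?sqrtr_ge0// -sqrtr_sqr ler_wsqrtr//.
rewrite sqrrD !sqr_sqrtr//.
by have := mulr_ge0 (sqrtr_ge0 y) (sqrtr_ge0 z); lra.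
Qed.

(** The root is subadditive, and shifting the cells by one in either direction does not increase the
    sum; on the right this uses that the cell of index [4 ^ l] is empty. *)
Lemma sum_sqrt_fat l : \sum_(i < 4 ^ l) Num.sqrt (fat l i) <= 3 * \sum_(i < 4 ^ l) Num.sqrt (M l i).
Proof.
pose p i := if i is i'.+1 then M l i' else 0.
have p0 i : 0 <= p i by rewrite /p; case: i.
apply: (@le_trans _ _ (\sum_(i < 4 ^ l) (Num.sqrt (p i) + Num.sqrt (M l i) + Num.sqrt (M l i.+1)))).
  apply: ler_sum => i _; apply: le_trans (sqrtD_le (addr_ge0 (p0 i) (M_ge0 l i)) (M_ge0 l i.+1)) _.
  by rewrite lerD2r sqrtD_le.
rewrite !big_split/=.
have N0 : (0 < 4 ^ l)%N by rewrite expn_gt0.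
have MN : M l (4 ^ l) = 0.
  by apply: M_empty; apply/negP => /inhabP[n nl]; have := cell_lt l n; rewrite nl ltnn.
have h1 : \sum_(i < 4 ^ l) Num.sqrt (p i) <= \sum_(i < 4 ^ l) Num.sqrt (M l i).
  case: (4 ^ l)%N N0 => // N _; rewrite big_ord_recl [p _]/= sqrtr0 add0r big_ord_recr/=.
  by rewrite lerDl sqrtr_ge0.
have h2 : \sum_(i < 4 ^ l) Num.sqrt (M l i.+1) <= \sum_(i < 4 ^ l) Num.sqrt (M l i).
  move: MN; case: (4 ^ l)%N N0 => // N _ MN; rewrite big_ord_recr/= MN sqrtr0 addr0 big_ord_recl/=.
  by rewrite lerDr sqrtr_ge0.
lra.
Qed.

Hypothesis fat_gt0 : forall k n, 0 < fat k (cell x k n).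

(** All paths through the cell share the first term [u], so their continuations from the children
    have sums at most [s - u]; this is the form in which the induction hypothesis is applied. *)
Lemma treeV_sqr_le d k i s :
  (forall n, cell x k n = i ->
    \sum_(l < d.+1) 2^-1 ^+ (k + l) / Num.sqrt (fat (k + l) (cell x (k + l) n)) <= s) ->
  inhab x k i -> treeV x d k i ^+ 2 <= s * tsum (fun k i => 2^-1 ^+ k * Num.sqrt (fat k i)) d k i.
Proof.
elim: d k i s => [|d IH] k i s hs ki.
  have /inhabP[n ni] := ki; have := hs n ni; rewrite big_ord_recl big_ord0 addr0 addn0 ni => h.
  rewrite treeV0//= addr0 -(@sqrt_half _ (fat k i)); last by rewrite -ni.
  by rewrite ler_wpM2r// mulr_ge0 ?exprn_ge0 ?sqrtr_ge0.
have f0 : 0 < fat k i by have /inhabP[n <-] := ki.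
set u := 2^-1 ^+ k / Num.sqrt (fat k i); set v := 2^-1 ^+ k * Num.sqrt (fat k i).
have v0 : 0 <= v by rewrite mulr_ge0 ?sqrtr_ge0 ?exprn_ge0.
have u0 : 0 <= u by rewrite divr_ge0 ?sqrtr_ge0 ?exprn_ge0.
have uv : u * v = (2^-1 ^+ k) ^+ 2 by exact: sqrt_half.
have hs' n : cell x k n = i -> \sum_(l < d.+1) 2^-1 ^+ (k.+1 + l) /
    Num.sqrt (fat (k.+1 + l) (cell x (k.+1 + l) n)) <= s - u.
  move=> ni; rewrite lerBrDl; apply: le_trans (hs n ni); rewrite [leRHS]big_ord_recl /= addn0 ni.
  by rewrite lerD2l; under [leRHS]eq_bigr do rewrite /bump/= add1n -addSnnS.
have su : 0 <= s - u.
  have /inhabP[n ni] := ki; apply: le_trans (hs' n ni).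
  by apply: sumr_ge0 => l _; rewrite divr_ge0 ?sqrtr_ge0 ?exprn_ge0.
rewrite treeVS// [tsum _ _ _ _]/= -/v; set W := \sum_(j < 4) tsum _ _ _ _.
set S := \sum_(j < 4) _.
have S0 : 0 <= S by apply: sumr_ge0 => j _; exact: sqr_ge0.
have SW : S <= (s - u) * W.
  rewrite mulr_sumr; apply: ler_sum => j _.
  have [h|h] := boolP (inhab x k.+1 (4 * i + j)).
    by apply: IH => // n nj; apply: hs'; exact: (cellS_in x_ge0 (ltn_ord j) nj).
  rewrite treeV_empty// expr0n mulr_ge0// tsumE; apply: sumr_ge0 => l _.
  by apply: sumr_ge0 => r _; rewrite mulr_ge0 ?sqrtr_ge0 ?exprn_ge0.
have W0 : 0 <= W.
  apply: sumr_ge0 => j _; rewrite tsumE; apply: sumr_ge0 => l _.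
  by apply: sumr_ge0 => r _; rewrite mulr_ge0 ?sqrtr_ge0 ?exprn_ge0.
have b0 : 0 <= 2^-1 ^+ k :> R by rewrite exprn_ge0.
have sS := sqr_sqrtr S0; have sS0 := sqrtr_ge0 S.
move: (2^-1 ^+ k) (Num.sqrt S) uv b0 sS sS0 => b r uv b0 sS sS0.
rewrite -sS in SW.
(* Cauchy-Schwarz: (b + r)^2 <= (u + s') (v + W) with b^2 = u v and r^2 <= s' W. *)
have br : (b * r) ^+ 2 <= (u * v) * ((s - u) * W).
  by rewrite exprMn -uv ler_wpM2l// mulr_ge0.
have uW := mulr_ge0 u0 W0; have vs := mulr_ge0 v0 su.
have amgm : 2 * (b * r) <= u * W + v * (s - u).
  rewrite -[leLHS]ger0_norm; last by rewrite !mulr_ge0.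
  rewrite -[leRHS]ger0_norm ?addr_ge0// -ler_sqr ?nnegrE// !real_normK ?num_real//.
  have := sqr_ge0 (u * W - v * (s - u)); nra.
nra.
Qed.

Hypothesis M_root : M 0 0 <= 1.

Lemma treeV_le_path S : (forall n d,
    \sum_(l < d.+1) 2^-1 ^+ l / Num.sqrt (fat l (cell x l n)) <= S) ->
  forall d, treeV x d 0 0 <= 3 * S.
Proof.
move=> hS d.
have c0 n : cell x 0 n = 0%N by exact: cell0.
have r0 : inhab x 0 0 by apply/inhabP; exists 0%N.
have V0 : 0 < treeV x d 0 0 by exact: treeV_gt0.
have S0 : 0 <= S.
  apply: le_trans (hS 0%N 0%N); apply: sumr_ge0 => l _.
  by rewrite divr_ge0 ?sqrtr_ge0 ?exprn_ge0.
have h1 := @treeV_sqr_le d 0 0 S (fun n _ => hS n d) r0.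
have h2 : tsum (fun k i => 2^-1 ^+ k * Num.sqrt (fat k i)) d 0 0 <=
    3 * tsum (fun k i => 2^-1 ^+ k * Num.sqrt (M k i)) d 0 0.
  rewrite !tsumE mulr_sumr; apply: ler_sum => l _.
  rewrite muln0 add0n; under eq_bigr do rewrite add0n.
  under [in leRHS]eq_bigr do rewrite add0n.
  by rewrite -!mulr_sumr mulrCA ler_wpM2l ?exprn_ge0// sum_sqrt_fat.
have h3 := tsum_le_treeV d 0 0.
have h4 : Num.sqrt (M 0 0) <= 1 by rewrite -[leRHS]sqrtr1 ler_wsqrtr.
have h5 : tsum (fun k i => 2^-1 ^+ k * Num.sqrt (fat k i)) d 0 0 <= 3 * treeV x d 0 0.
  apply: le_trans h2 _; rewrite ler_pM2l//; apply: le_trans h3 _.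
  by rewrite ler_piMl// ltW.
have h6 := le_trans h1 (ler_wpM2l S0 h5).
rewrite -(ler_pM2r V0); apply: le_trans (_ : treeV x d 0 0 ^+ 2 <= _); first by rewrite expr2.
by apply: le_trans h6 _; rewrite le_eqVlt; apply/orP; left; apply/eqP; ring.
Qed.

End mass.
End measure_upper_bound.

(** The superlevel sets of a nonincreasing function on an interval are intervals. *)
Lemma measurable_nonincreasing_itv (R : realType) (D : set R) (f : R -> \bar R) :
  is_interval D -> (forall r s, D r -> D s -> r <= s -> (f s <= f r)%E) -> measurable_fun D f.
Proof.
move=> iD f_ni mD; apply: (measurability _ (ErealGenCInfty.measurableE R)) => //= _ [_ [y ->] <-].
apply: is_interval_measurable => s t /=; rewrite !in_itv/= !andbT.
move=> [Ds ys] [Dt yt] u sut; have Du := iD _ _ Ds Dt _ sut; split => //.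
by rewrite in_itv/= andbT; apply: le_trans yt _; apply: f_ni => //; case/andP: sut.
Qed.

(** * Dyadic comparison for the integral of a nonincreasing function *)

Section dyadic_integral.
Variables (R : realType) (f : R -> \bar R) (c : R).
Local Open Scope ereal_scope.
Hypothesis c_gt0 : (0 < c)%R.
Hypothesis f_ge0 : forall r, 0 <= f r.
Hypothesis f_ni : forall r s, (0 <= r)%R -> (r <= s)%R -> (s <= c)%R -> f s <= f r.

Lemma measurable_nonincreasing : measurable_fun `[0%R, c] f.
Proof.
apply: measurable_nonincreasing_itv => [|r s /=]; first exact: interval_is_interval.
by rewrite !in_itv/= => /andP[r0 _] /andP[_ sc] rs; exact: f_ni.
Qed.

Let dp (k : nat) : R := (c * 2^-1 ^+ k)%R.

Let dp_gt0 k : (0 < dp k)%R. Proof. by rewrite mulr_gt0// exprn_gt0. Qed.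

Let dpS k : dp k.+1 = (dp k / 2)%R.
Proof. by rewrite /dp exprSr mulrA. Qed.

Let dp_le k l : (k <= l)%N -> (dp l <= dp k)%R.
Proof.
move=> kl; rewrite /dp ler_pM2l//; apply: ler_wiXn2l => //.
by rewrite invf_le1// ler1n.
Qed.

Let dp_c k : (dp k <= c)%R.
Proof. by have := dp_le (leq0n k); rewrite {2}/dp expr0 mulr1. Qed.

Let ring_ (k : nat) : set R := `]dp k.+1, dp k]%classic.

Let ring_triv : trivIset setT ring_.
Proof.
apply/trivIsetP => i j _ _; wlog ij : i j / (i < j)%N.
  move=> H; rewrite neq_ltn => /orP[ij|ij]; first by apply: H => //; rewrite neq_ltn ij.
  by rewrite setIC; apply: H => //; rewrite neq_ltn ij.
move=> _; apply/seteqP; split=> // r []; rewrite /ring_ /= !in_itv/= => /andP[h1 _] /andP[_ h2].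
by have := lt_le_trans h1 (le_trans h2 (dp_le ij)); rewrite ltxx.
Qed.

Let ring_sub k : ring_ k `<=` `[0%R, c].
Proof.
move=> r; rewrite /ring_ /= !in_itv/= => /andP[h1 h2]; rewrite (le_trans h2)// andbT ltW//.
exact: lt_trans h1.
Qed.

Let mring k : measurable (ring_ k). Proof. exact: measurable_itv. Qed.

Let leb_ring k : lebesgue_measure (ring_ k) = (dp k.+1)%:E.
Proof.
have h : (dp k.+1 < dp k)%R by rewrite dpS ltr_pdivrMr// ltr_pMr ?dp_gt0// ltr1n.
by rewrite lebesgue_measure_itv/= lte_fin h -EFinD; congr (_%:E); rewrite dpS; field.
Qed.

(** On [ring_ k], whose length is [dp k.+1], the function is at least its value at the right end. *)
Lemma dyadic_sum_le_integral d :
  \sum_(k < d) (dp k.+1)%:E * f (dp k) <= \int[lebesgue_measure]_(r in `[0%R, c]) f r.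
Proof.
have mf := measurable_nonincreasing.
pose D := \big[setU/set0]_(k <- index_iota 0 d) ring_ k.
have DE : D `<=` `[0%R, c] by rewrite /D -bigcup_seq => r [k _]; exact: ring_sub.
have mD : measurable D by apply: bigsetU_measurable => k _; exact: measurable_itv.
apply: (@le_trans _ _ (\int[lebesgue_measure]_(r in D) f r)); last exact: ge0_subset_integral.
rewrite ge0_integral_bigsetU ?iota_uniq//=; last 2 first.
- exact: sub_trivIset ring_triv.
- exact: measurable_funS mf.
rewrite big_mkord; apply: lee_sum => k _.
rewrite muleC -leb_ring -(@integral_cst _ _ _ (@lebesgue_measure R) _ (mring k)); apply: ge0_le_integral.
- exact: mring.
- by move=> r _; exact: f_ge0.
- exact: measurable_cst.
- by apply: measurable_funS mf; [exact: measurable_itv|exact: ring_sub].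
- move=> r /[dup] /ring_sub; rewrite /ring_ /= !in_itv/= => /andP[r0 _] /andP[_ rk].
  by apply: f_ni.
Qed.

(** Here the value at the left end of [ring_ k] bounds the function from above. *)
Lemma integral_le_dyadic C :
  (forall d, \sum_(k < d) (dp k.+1)%:E * f (dp k.+1) <= C) ->
  \int[lebesgue_measure]_(r in `[0%R, c]) f r <= C.
Proof.
move=> hC; have mf := measurable_nonincreasing.
have E0 : `]0%R, c]%classic = \bigcup_k ring_ k.
  apply/seteqP; split=> r /=.
    rewrite in_itv/= => /andP[r0 rc].
    have [k hk] : exists k, (dp k < r)%R.
      exists (Num.truncn (c / r)).+1; rewrite /dp exprVn ltr_pdivrMr ?exprn_gt0//.
      rewrite -ltr_pdivrMl// mulrC; apply: lt_trans (truncnS_gt _) _.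
      by rewrite -natrX ltr_nat ltn_expl.
    have [k0 k0P k0m] := ex_minnP (ex_intro (fun k => (dp k < r)%R) k hk).
    case: k0 k0P k0m => [|k0] k0P k0m.
      by move: k0P; rewrite /dp expr0 mulr1 ltNge rc.
    exists k0 => //; rewrite /ring_ /= in_itv/= k0P/= leNgt; apply/negP => /k0m.
    by rewrite ltnn.
  move=> [k _ rk]; have := ring_sub rk; move: rk; rewrite /ring_ /= !in_itv/= => /andP[h1 _] /andP[_ ->].
  by rewrite andbT; exact: lt_trans h1.
(* The rings cover only the positive radii; the endpoint 0 is removed as a null set. *)
rewrite -integral_itv_obnd_cbnd; last first.
  by apply: measurable_funS mf => // r /=; rewrite !in_itv/= => /andP[/ltW-> ->].
rewrite E0 ge0_integral_bigcup//; last first.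
  rewrite -E0; apply: measurable_funS mf => // r /=; rewrite !in_itv/= => /andP[/ltW-> ->]//.
apply: lime_le; first by apply: is_cvg_nneseries => n _ _; exact: integral_ge0.
apply: nearW => d; apply: le_trans (hC d); rewrite big_mkord; apply: lee_sum => k _.
rewrite muleC -leb_ring -(@integral_cst _ _ _ (@lebesgue_measure R) _ (mring k)); apply: ge0_le_integral.
- exact: mring.
- by move=> r _; exact: f_ge0.
- by apply: measurable_funS mf; [exact: measurable_itv|exact: ring_sub].
- exact: measurable_cst.
- move=> r /[dup] /ring_sub; rewrite /ring_ /= !in_itv/= => /andP[_ rc] /andP[kr _].
  by apply: f_ni => //; exact: ltW.
Qed.

End dyadic_integral.

Section increasing_partial_sums.
Variables (R : realType) (a : nat -> R).
Hypothesis a_gt0 : forall n, 0 < a n.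

Lemma psum_inc n k : (n < k)%N -> psum a n < psum a k.
Proof.
by move=> nk; apply: lt_le_trans (psum_nd a nk); rewrite psumS ltrDl exprn_gt0.
Qed.

Lemma psum_inj : injective (psum a).
Proof.
move=> n k e; have [nk|kn|//] := ltngtP n k.
  by have := psum_inc nk; rewrite e ltxx.
by have := psum_inc kn; rewrite e ltxx.
Qed.

Lemma psum_limit K : (forall n, psum a n <= K) -> exists l,
  (forall n, psum a n < l) /\ (forall y, y < l -> exists n, y < psum a n).
Proof.
move=> hK; have hs : has_sup (range (psum a)).
  by split; [exists (psum a 0), 0%N|exists K => _ [n _ <-]].
exists (sup (range (psum a))); split=> [n|y ys].
  apply: lt_le_trans (psum_inc (ltnSn n)) _.
  by apply: ub_le_sup; [exact: hs.2|exists n.+1].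
have [_ [n _ <-] h] := sup_gt hs.1 ys.
by exists n.
Qed.

End increasing_partial_sums.

(** * The set T, its balls, and the cell masses of a measure on it *)

Section partial_square_sets.
Variables (R : realType) (a : nat -> R).
Local Notation T := (partial_squares a).

Lemma partial_squaresE : T = range (psum a).
Proof.
apply/seteqP; split=> t.
  by move=> [->|[m _ <-]]; [exists 0%N; rewrite ?psum0|exists m].
move=> [[|m] _ <-]; first by left; rewrite psum0.
by right; exists m.+1.
Qed.

Lemma measurable_psum_image (A : set nat) : measurable (psum a @` A : set (measurableTypeR R)).
Proof.
apply: countable_measurable => [t|]; first exact: measurable_set1.
exact: card_le_trans (card_image_le _ _) (countableP _).
Qed.

Lemma cball_inE n r : cball_in T (psum a n) r = psum a @` [set k | `|psum a k - psum a n| <= r].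
Proof.
rewrite /cball_in partial_squaresE; apply/seteqP; split=> t /=.
  by move=> [[k _ <-] h]; exists k.
by move=> [k h <-]; split => //; exists k.
Qed.

Lemma diameter_bounded l : (forall n, psum a n <= l) -> (forall y, y < l -> exists n, y < psum a n) ->
  diameter T = l%:E.
Proof.
move=> al la; rewrite /diameter partial_squaresE; apply/le_anti/andP; split.
  apply: ge_ereal_sup => _ [_ [n _ <-] [_ [k _ <-] <-]].
  rewrite lee_fin ler_norml; have := psum_ge0 a n; have := psum_ge0 a k.
  by have := al n; have := al k => *; apply/andP; split; lra.
apply/lee_subgt0Pr => e e0; have [|n hn] := la (l - e); first lra.
apply: le_trans (ereal_sup_ubound _); last first.
  by exists (psum a n); [exists n|exists (psum a 0); [exists 0%N|]].
by rewrite -EFinB lee_fin psum0 subr0 (le_trans (ltW hn))// ler_norm.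
Qed.

Lemma diameter_unbounded : (forall K, exists n, K < psum a n) -> diameter T = +oo%E.
Proof.
move=> h; apply/eqyP => K K0.
have [n hn] := h K; apply: le_trans (ereal_sup_ubound _); last first.
  by rewrite partial_squaresE; exists (psum a n); [exists n|exists (psum a 0); [exists 0%N|]].
by rewrite lee_fin psum0 subr0 (le_trans (ltW hn))// ler_norm.
Qed.

Section integrand.
Variable m : probability (measurableTypeR R) R.

Definition integrand (t r : R) : \bar R := ((sqrte (m (cball_in T t (r ^+ 2))))^-1)%E.

Lemma integrand_ni n r s : 0 <= r -> r <= s -> (integrand (psum a n) s <= integrand (psum a n) r)%E.
Proof.
move=> r0 rs; rewrite /integrand lee_pV2 ?inE ?sqrte_ge0// lee_sqrt ?measure_ge0// !cball_inE.
apply: le_measure; rewrite ?inE; [exact: measurable_psum_image..|].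
apply: image_subset => k /= h; apply: le_trans h _.
by rewrite ler_sqr ?nnegrE// (le_trans r0).
Qed.

Lemma integrand_ge0 t r : (0 <= integrand t r)%E.
Proof. by rewrite /integrand inve_ge0 sqrte_ge0. Qed.

Lemma sqrte1 : sqrte 1%E = 1%E :> \bar R.
Proof. by rewrite /= sqrtr1. Qed.

Lemma integrand_ge1 n r : (1 <= integrand (psum a n) r)%E.
Proof.
rewrite /integrand inve_ge1 ?sqrte_ge0// -sqrte1 lee_sqrt// probability_le1//.
by rewrite cball_inE; exact: measurable_psum_image.
Qed.

(** The integrand is at least 1, so an unbounded T, whose domain of integration is a half-line,
    would give an infinite integral. *)
Lemma majorizing_bounded : majorizing_measure T m -> exists K, forall n, psum a n <= K.
Proof.
move=> [_ mm]; apply: contrapT => nK.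
have h K : exists n, K < psum a n.
  apply: contrapT => hK; apply: nK; exists K => n; rewrite leNgt; apply/negP => Kn.
  by apply: hK; exists n.
move: mm; rewrite diameter_unbounded//= ltNge => /negP; apply.
have T0 : T (psum a 0) by rewrite partial_squaresE; exists 0%N.
apply: le_trans (ereal_sup_ubound _); last by exists (psum a 0).
rewrite -/(integrand _ _).
have -> : [set r : R | (0%:E <= r%:E <= +oo)%E] = `[0, +oo[%classic.
  by apply/seteqP; split=> r /=; rewrite in_itv/= lee_fin leey.
apply: (@le_trans _ _ (\int[lebesgue_measure]_(r in `[0%R, +oo[) cst 1%E r)%E).
  by rewrite integral_cst//= mul1e lebesgue_measure_itv/= ltry.
apply: ge0_le_integral => //.
- apply: measurable_nonincreasing_itv => [|r s]; first exact: interval_is_interval.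
  by rewrite /= !in_itv/= !andbT => r0 _; exact: integrand_ni.
- by move=> r _; exact: integrand_ge1.
Qed.

Section bounded.
Variable l : R.
Hypothesis psum_lt : forall n, psum a n < l.
Hypothesis psum_sup : forall y, y < l -> exists n, y < psum a n.

Let l0 : 0 < l. Proof. by rewrite -(psum0 a). Qed.

Lemma integral_domainE : [set r : R | (0%:E <= r%:E <= sqrte (diameter T))%E] = `[0, Num.sqrt l]%classic.
Proof.
have al n : psum a n <= l by exact: ltW.
by rewrite (diameter_bounded al).
Qed.

Let x n := psum a n / l.
Let x0 n : 0 <= x n. Proof. exact: x_ge0. Qed.
Let x1 n : x n < 1. Proof. exact: x_lt1. Qed.

Definition cmass k i : R := fine (m (psum a @` [set n | cell x k n = i])).

Let mE (A : set nat) : (fine (m (psum a @` A)))%:E = m (psum a @` A).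
Proof. by rewrite fineK// fin_num_measure//; exact: measurable_psum_image. Qed.

Lemma cmass_ge0 k i : 0 <= cmass k i.
Proof. by rewrite fine_ge0. Qed.

Lemma cmass_empty k i : ~~ inhab x k i -> cmass k i = 0.
Proof.
move=> h; rewrite /cmass (_ : [set n | _] = set0) ?image_set0 ?measure0//.
by apply/seteqP; split=> // n /= e; move/negP: h; apply; rewrite -e inhab_cell.
Qed.

Hypothesis a_gt0 : forall n, 0 < a n.

Lemma cmass_child k i : \sum_(j < 4) cmass k.+1 (4 * i + j) <= cmass k i.
Proof.
rewrite -lee_fin -sumEFin; under eq_bigr do rewrite /cmass mE.
pose F (j : 'I_4) := psum a @` [set n | cell x k.+1 n = (4 * i + j)%N].
rewrite -(@measure_bigsetU_ord _ _ _ m 4 xpredT F); last 2 first.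
- by move=> j; exact: measurable_psum_image.
- apply/trivIsetP => j j' _ _ /eqP jj; apply/seteqP; split=> // t [[n ni <-] [n' ni' /(psum_inj a_gt0) nn]].
  by apply: jj; apply/val_inj/eqP; rewrite -(eqn_add2l (4 * i)) -ni -ni' nn.
rewrite mE; apply: le_measure; rewrite ?inE.
- by apply: bigsetU_measurable => j _; exact: measurable_psum_image.
- exact: measurable_psum_image.
rewrite -bigcup_seq => t [j _ [n nj <-]]; exists n => //=.
exact: cellS_in nj.
Qed.

(** After division by [l] the radius is the side of a cell, so a point of the ball lies in the cell
    of [x n] or in one adjacent to it. *)
Lemma cball_fat k n : (m (cball_in T (psum a n) (l * (2^-1 ^+ k) ^+ 2)) <= (fat cmass k (cell x k n))%:E)%E.
Proof.
set i := cell x k n.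
pose C j := psum a @` [set p | cell x k p = j].
pose P : set (measurableTypeR R) := if i is i'.+1 then C i' else set0.
have mC j : measurable (C j : set (measurableTypeR R)) by exact: measurable_psum_image.
have mP : measurable P by rewrite /P; case: (i) => [|i']; [exact: measurable0|exact: mC].
have -> : (fat cmass k i)%:E = (m P + m (C i) + m (C i.+1))%E.
  rewrite /fat !EFinD /cmass !mE; congr (_ + _ + _)%E.
  by rewrite /P; case: (i) => [|i']; rewrite ?measure0// mE.
apply: le_trans (leeD (measureU2 _ mP (mC i)) (lexx _)).
apply: le_trans (measureU2 _ _ _) => //; last exact: measurableU.
rewrite cball_inE; apply: le_measure; rewrite ?inE; first exact: measurable_psum_image.
  by apply: measurableU => //; exact: measurableU.
move=> _ [p hp <-].
have /andP[h1 h2] := cell_itv x0 k n; have /andP[h3 h4] := cell_itv x0 k p; rewrite -/i in h1 h2.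
have p4 : 0 < 4 ^+ k :> R by rewrite exprn_gt0.
have : `|4 ^+ k * x p - 4 ^+ k * x n| <= 1.
  rewrite /x -mulrBr -mulrBl !normrM (gtr0_norm p4) (gtr0_norm (_ : 0 < l^-1)) ?invr_gt0//.
  rewrite mulrA ler_pdivrMr// mul1r -ler_pdivlMl//.
  by apply: le_trans hp _; rewrite mulrC exprAC (_ : 2^-1 ^+ 2 = 4^-1) ?exprVn ?mul1r//; field.
rewrite ler_norml => /andP[h5 h6].
have ip : (i <= (cell x k p).+1)%N.
  rewrite -ltnS -(ltr_nat R) -[(cell x k p).+2%:R]natr1.
  by move: h1 h4 h5; move: (4 ^+ k * x p) (4 ^+ k * x n) (i%:R : R) ((cell x k p).+1%:R : R) => *; lra.
have pi : (cell x k p <= i.+1)%N.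
  rewrite -ltnS -(ltr_nat R) -[i.+2%:R]natr1.
  by move: h2 h3 h6; move: (4 ^+ k * x p) (4 ^+ k * x n) (i.+1%:R : R) ((cell x k p)%:R : R) => *; lra.
have : (cell x k p).+1 = i \/ cell x k p = i \/ cell x k p = i.+1 by lia.
move=> [e|[e|e]]; [left; left|left; right|right]; [|by exists p..].
by rewrite /P -e; exists p.
Qed.

Lemma majorizing_treeV : majorizing_measure T m -> exists B, forall d, treeV x d 0 0 <= B.
Proof.
move=> [_]; rewrite integral_domainE; set Sup := ereal_sup _ => Soo.
have sl0 : 0 < Num.sqrt l by rewrite sqrtr_gt0.
have path n d : (\sum_(k < d) (Num.sqrt l * 2^-1 ^+ k.+1)%:E *
    integrand (psum a n) (Num.sqrt l * 2^-1 ^+ k) <= Sup)%E.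
  apply: le_trans (ereal_sup_ubound _); last first.
    by exists (psum a n) => //; rewrite partial_squaresE; exists n.
  apply: dyadic_sum_le_integral => //; first by move=> r; exact: integrand_ge0.
  by move=> r s r0 rs _; exact: integrand_ni.
have S0 : (0 <= Sup)%E.
  by have := path 0%N 0%N; rewrite big_ord0.
have sE k : (Num.sqrt l * 2^-1 ^+ k) ^+ 2 = l * (2^-1 ^+ k) ^+ 2.
  by rewrite exprMn sqr_sqrtr// ltW.
have ck k : 0 < Num.sqrt l * 2^-1 ^+ k by rewrite mulr_gt0// exprn_gt0.
(* If this mass vanished, the ball inside would be null, the integrand at radius
   [Num.sqrt l * 2^-1 ^+ k] infinite, and so would be [Sup]. *)
have fat_gt0 k n : 0 < fat cmass k (cell x k n).
  have f0 := fat_ge0 cmass_ge0 k (cell x k n).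
  rewrite lt0r f0 andbT; apply/eqP => e.
  have := cball_fat k n; rewrite e => m0.
  have {}m0 : m (cball_in T (psum a n) (l * (2^-1 ^+ k) ^+ 2)) = 0%E.
    by apply/le_anti; rewrite m0 measure_ge0.
  have := path n k.+1; rewrite big_ord_recr/= {2}/integrand sE m0 sqrte0 inve0 gt0_muley ?lte_fin//.
  rewrite addey; first by rewrite leye_eq => /eqP e'; move: Soo; rewrite e' ltxx.
  rewrite gt_eqF//; apply: lt_le_trans ltNy0 _; apply: sume_ge0 => j _.
  by rewrite mule_ge0 ?integrand_ge0// lee_fin ltW.
have SE : Sup = (fine Sup)%:E by rewrite fineK// ge0_fin_numE.
(* The 3 comes from [treeV_le_path]; the 2 appears because the dyadic sum carries [2^-1 ^+ k.+1] in
   place of [2^-1 ^+ k]. *)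
exists (3 * (2 * fine Sup / Num.sqrt l)) => d.
apply: (treeV_le_path x0 x1 cmass_ge0 cmass_empty cmass_child fat_gt0) => [|n e].
  rewrite /cmass -lee_fin mE probability_le1//; exact: measurable_psum_image.
rewrite -lee_fin -sumEFin.
have := path n e.+1; rewrite SE => hp.
have : (\sum_(k < e.+1) (Num.sqrt l * 2^-1 ^+ k.+1 / Num.sqrt (fat cmass k (cell x k n)))%:E <=
    (fine Sup)%:E)%E.
  apply: le_trans hp; apply: lee_sum => k _; rewrite EFinM.
  apply: lee_wpmul2l; first by rewrite lee_fin ltW.
  have -> : ((Num.sqrt (fat cmass k (cell x k n)))^-1)%:E = ((sqrte (fat cmass k (cell x k n))%:E)^-1)%E.
    by rewrite /= inver gt_eqF// sqrtr_gt0.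
  rewrite /integrand lee_pV2 ?inE ?sqrte_ge0// sE lee_sqrt ?cball_fat//.
  by rewrite lee_fin ltW.
rewrite !sumEFin !lee_fin => h.
rewrite ler_pdivlMr// -[leRHS]mulrC.
have -> : (\sum_(k < e.+1) 2^-1 ^+ k / Num.sqrt (fat cmass k (cell x k n))) * Num.sqrt l =
   2 * \sum_(k < e.+1) Num.sqrt l * 2^-1 ^+ k.+1 / Num.sqrt (fat cmass k (cell x k n)).
  rewrite mulr_sumr mulr_suml; apply: eq_bigr => k _; rewrite exprS.
  have : Num.sqrt (fat cmass k (cell x k n)) != 0 by rewrite gt_eqF// sqrtr_gt0.
  by move: (Num.sqrt (fat _ _ _)) (2^-1 ^+ k) => u v u0; field.
by rewrite mulrC; lra.
Qed.

End bounded.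
End integrand.
End partial_square_sets.

(** * Construction of a majorizing measure *)

Section optimal_masses.
Variables (R : realType) (x : nat -> R) (B : R).
Hypothesis x_ge0 : forall n, 0 <= x n.
Hypothesis x_lt1 : forall n, x n < 1.
Hypothesis VB : forall d, treeV x d 0 0 <= B.

Let V := Vlim x.
Let S k i := \sum_(j < 4) V k (4 * i + j) ^+ 2.

Let V_gt0 k i : inhab x k i -> 0 < V k i. Proof. exact: Vlim_gt0 x_lt1 VB _ _. Qed.
Let V_empty k i : ~~ inhab x k i -> V k i = 0. Proof. exact: Vlim_empty x_lt1 VB _ _. Qed.

Let S_gt0 k i : inhab x k i -> 0 < S k.+1 i.
Proof.
move=> /inhabP[n <-]; have [j ej _] := cell_child x_ge0 k n.
rewrite /S (bigD1 j)//= ltr_wpDr ?sumr_ge0//; first by move=> q _; exact: sqr_ge0.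
by rewrite exprn_gt0// V_gt0// -ej inhab_cell.
Qed.

(* The mass of a cell is shared between its children in proportion to the
   squares of their values V. *)
Fixpoint tmass k (i : nat) : R :=
  if k is k'.+1 then tmass k' (i %/ 4)%N * (V k i ^+ 2 / S k (i %/ 4)%N) else (i == 0%N)%:R.

Lemma tmassS k i (j : 'I_4) :
  tmass k.+1 (4 * i + j) = tmass k i * (V k.+1 (4 * i + j) ^+ 2 / S k.+1 i).
Proof. by rewrite /= mulnC divnMDl// divn_small// addn0. Qed.

Lemma tmass_ge0 k i : 0 <= tmass k i.
Proof.
elim: k i => [|k IH] i /=; first exact: ler0n.
by rewrite mulr_ge0// divr_ge0 ?sqr_ge0// sumr_ge0// => j _; exact: sqr_ge0.
Qed.

Lemma tmass_empty k i : ~~ inhab x k i -> tmass k i = 0.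
Proof.
case: k => [|k] h /=; last by rewrite V_empty// expr0n mul0r mulr0.
case: eqP => // i0; exfalso; move/negP: h; apply; apply/inhabP.
by exists 0%N; rewrite i0 cell0.
Qed.

Lemma tmass_sum k i : \sum_(j < 4) tmass k.+1 (4 * i + j) = tmass k i.
Proof.
have [h|h] := boolP (inhab x k i).
  under eq_bigr do rewrite tmassS.
  by rewrite -mulr_sumr -mulr_suml divff ?mulr1// gt_eqF// S_gt0.
rewrite (tmass_empty h) big1// => j _; apply: tmass_empty.
by apply: contra h; exact: inhab_parent.
Qed.

Lemma tmass_cellS k n : exists2 q, 0 < q &
  tmass k.+1 (cell x k.+1 n) = tmass k (cell x k n) * (V k.+1 (cell x k.+1 n) / q) ^+ 2 /\
  q ^+ 2 = S k.+1 (cell x k n).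
Proof.
have [j ej _] := cell_child x_ge0 k n; have S0 := S_gt0 (inhab_cell x k n).
exists (Num.sqrt (S k.+1 (cell x k n))); first by rewrite sqrtr_gt0.
have e := sqr_sqrtr (ltW S0); split => //.
by rewrite ej tmassS exprMn exprVn e.
Qed.

Lemma tmass_gt0 k n : 0 < tmass k (cell x k n).
Proof.
elim: k => [|k IH]; first by rewrite /= cell0.
have [q q0 [-> _]] := tmass_cellS k n.
by rewrite mulr_gt0// exprn_gt0// divr_gt0// V_gt0// inhab_cell.
Qed.

(** With q the root of the sum of the squared values of the children, the sharing rule gives [V d.+1
    / sqrt (tmass d.+1) = q / sqrt (tmass d)] along the path. Since [V d >= 2^-1 ^+ d + q], each
    step releases the term [2^-1 ^+ d / sqrt (tmass d)]. *)
Lemma tmass_telescope n d : \sum_(l < d) 2^-1 ^+ l / Num.sqrt (tmass l (cell x l n)) +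
  V d (cell x d n) / Num.sqrt (tmass d (cell x d n)) <= V 0 0.
Proof.
elim: d => [|d IH]; first by rewrite big_ord0 add0r cell0//= sqrtr1 divr1.
apply: le_trans IH; rewrite big_ord_recr/= -addrA lerD2l.
have [q q0 [e qS]] := tmass_cellS d n.
have m0 := tmass_gt0 d n; have r0 : 0 < Num.sqrt (tmass d (cell x d n)) by rewrite sqrtr_gt0.
have V0 : 0 < V d.+1 (cell x d.+1 n) by rewrite V_gt0// inhab_cell.
rewrite -[tmass d _ * _]/(tmass d.+1 _) e sqrtrM ?(ltW m0)// sqrtr_sqr ger0_norm; last first.
  by rewrite divr_ge0 ?(ltW V0)// ltW.
have -> : V d.+1 (cell x d.+1 n) / (Num.sqrt (tmass d (cell x d n)) * (V d.+1 (cell x d.+1 n) / q)) =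
    q / Num.sqrt (tmass d (cell x d n)) by field; rewrite !gt_eqF.
rewrite -mulrDl ler_pM2r ?invr_gt0//.
have := VlimS x_ge0 x_lt1 VB (inhab_cell x d n).
by rewrite -/(S d.+1 (cell x d n)) -qS sqrtr_sqr ger0_norm// ltW.
Qed.

Lemma tmass_cell_le k n : tmass k.+1 (cell x k.+1 n) <= tmass k (cell x k n).
Proof.
have [j ej _] := cell_child x_ge0 k n; rewrite -(tmass_sum k (cell x k n)) ej (bigD1 j)//.
by rewrite lerDl sumr_ge0// => q _; exact: tmass_ge0.
Qed.

(** The mass left at the point [x n] itself, as the decreasing limit of the masses of the cells
    around it. *)
Definition atom n : R := limn (fun k => tmass k (cell x k n)).

Lemma tmass_ni n : nonincreasing_seq (fun k => tmass k (cell x k n)).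
Proof. by apply/nonincreasing_seqP => k; exact: tmass_cell_le. Qed.

Lemma atom_cvg n : tmass k (cell x k n) @[k --> \oo] --> atom n.
Proof.
apply: nonincreasing_is_cvgn; first exact: tmass_ni.
by exists 0 => _ [k _ <-] /=; exact: tmass_ge0.
Qed.

Lemma atom_le k n : atom n <= tmass k (cell x k n).
Proof.
apply: (nonincreasing_cvgn_ge (@tmass_ni n)).
by apply/cvg_ex; exists (atom n); exact: atom_cvg.
Qed.

Lemma atom_ge0 n : 0 <= atom n.
Proof.
apply: limr_ge; first by apply/cvg_ex; exists (atom n); exact: atom_cvg.
by apply: nearW => k; exact: tmass_ge0.
Qed.

Lemma sum_cell_child N k i (F : nat -> R) : \sum_(n < N | cell x k n == i) F n =
  \sum_(j < 4) \sum_(n < N | cell x k.+1 n == (4 * i + j)%N) F n.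
Proof.
pose p (n : 'I_N) : 'I_4 := inord (cell x k.+1 n %% 4).
rewrite (partition_big p xpredT)//=; apply: eq_bigr => j _; apply: eq_bigl => n.
have r4 : (cell x k.+1 n %% 4 < 4)%N by rewrite ltn_mod.
rewrite (cellS x_ge0 k n) -val_eqE /= inordK//.
have e := divn_eq (cell x k.+1 n) 4.
apply/andP/eqP => [[/eqP h1 /eqP h2]|h].
  by rewrite e h1 h2 mulnC.
by rewrite h mulnC divnMDl// modnMDl divn_small// modn_small// addn0 !eqxx.
Qed.

(** The indices below [N] occupy distinct cells at level [k + d], so no descendant is counted
    twice. *)
Lemma sum_tmass_le N d k i :
  (forall n m, (n < N)%N -> (m < N)%N -> cell x (k + d) n = cell x (k + d) m -> n = m) ->
  \sum_(n < N | cell x k n == i) tmass (k + d) (cell x (k + d) n) <= tmass k i.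
Proof.
elim: d k i => [|d IH] k i sep.
  move: sep; rewrite !addn0 => sep; have [[n0 /eqP ni]|no] := pselect (exists n : 'I_N, cell x k n == i).
    rewrite (bigD1 n0) ?ni//= big1 ?addr0// => n /andP[/eqP h /eqP h'].
    by exfalso; apply: h'; apply: val_inj; exact: (sep _ _ (ltn_ord n) (ltn_ord n0) (etrans h (esym ni))).
  rewrite big1 ?tmass_ge0// => n h; exfalso; apply: no; by exists n.
move: sep; rewrite addnS -addSn => sep.
rewrite (sum_cell_child _ _ _ (fun n => tmass (k.+1 + d) (cell x (k.+1 + d) n))) -tmass_sum.
by apply: ler_sum => j _; exact: IH.
Qed.

(** All indices in the cell are below [N], so every inhabited descendant is counted at least once
    and no mass is lost; points sharing a descendant only count it again. *)
Lemma sum_tmass_ge N d k i : (forall n, cell x k n = i -> (n < N)%N) ->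
  tmass k i <= \sum_(n < N | cell x k n == i) tmass (k + d) (cell x (k + d) n).
Proof.
elim: d k i => [|d IH] k i fin.
  rewrite addn0; have [/inhabP[n ni]|h] := boolP (inhab x k i); last first.
    by rewrite tmass_empty// sumr_ge0// => n _; exact: tmass_ge0.
  rewrite (bigD1 (Ordinal (fin n ni))) /= ?ni// lerDl sumr_ge0// => m _.
  exact: tmass_ge0.
rewrite addnS -addSn.
rewrite (sum_cell_child _ _ _ (fun n => tmass (k.+1 + d) (cell x (k.+1 + d) n))) -tmass_sum.
apply: ler_sum => j _; apply: IH => n nj; apply: fin; exact: (cellS_in x_ge0 (ltn_ord j) nj).
Qed.

Lemma sum_atom_ge N k i : (forall n, cell x k n = i -> (n < N)%N) ->
  tmass k i <= \sum_(n < N | cell x k n == i) atom n.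
Proof.
move=> fin.
have cs : (\sum_(n < N | cell x k n == i) tmass d (cell x d n)) @[d --> \oo] -->
    \sum_(n < N | cell x k n == i) atom n.
  by apply: cvg_big => [|n _]; [exact: add_continuous|exact: atom_cvg].
rewrite -(cvg_lim _ cs)//; apply: limr_ge; first by apply/cvg_ex; eexists; exact: cs.
exists k => // d /= kd; rewrite -(subnKC kd); exact: sum_tmass_ge.
Qed.

Lemma sum_atom_le N : (exists L, forall n m, (n < N)%N -> (m < N)%N -> cell x L n = cell x L m -> n = m) ->
  \sum_(n < N) atom n <= 1.
Proof.
move=> [L sep].
have := @sum_tmass_le N L 0 0; rewrite add0n => /(_ sep)/= h; apply: le_trans h.
rewrite [leRHS](eq_bigl xpredT); last by move=> n; rewrite cell0.
by apply: ler_sum => n _; exact: atom_le.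
Qed.

End optimal_masses.

Section discrete_measure.
Variables (R : realType) (u : nat -> R) (p : nat -> R).
Hypothesis u_ge0 : forall n, 0 <= u n.

Definition discrete_measure : {measure set (measurableTypeR R) -> \bar R} :=
  mseries (fun n => mscale (NngNum (u_ge0 n)) (@dirac _ (measurableTypeR R) (p n) R)) 0.

Lemma discrete_measureE A :
  discrete_measure A = (\sum_(0 <= n <oo) (u n * \1_A (p n))%:E)%E.
Proof. by apply: eq_eseriesr => n _; rewrite /mscale/= /dirac EFinM. Qed.

Lemma discrete_measure_ge N A :
  ((\sum_(n < N) u n * \1_A (p n))%:E <= discrete_measure A)%E.
Proof.
rewrite discrete_measureE -sumEFin -(big_mkord xpredT (fun n => (u n * \1_A (p n))%:E)).
by apply: nneseries_lim_ge => n _ _; rewrite lee_fin mulr_ge0.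
Qed.

Lemma discrete_measure_le C A : (forall N, \sum_(n < N) u n <= C) ->
  (discrete_measure A <= C%:E)%E.
Proof.
move=> hC; rewrite discrete_measureE; apply: lime_le.
  by apply: is_cvg_nneseries => n _ _; rewrite lee_fin mulr_ge0.
apply: nearW => N; rewrite big_mkord sumEFin lee_fin; apply: le_trans (hC N).
apply: ler_sum => n _; rewrite indicE; case: (_ \in _); rewrite ?mulr1// mulr0//.
Qed.

Lemma discrete_measure_full A : (forall n, A (p n)) -> discrete_measure A = discrete_measure setT.
Proof.
move=> pA; rewrite !discrete_measureE; apply: eq_eseriesr => n _.
by rewrite !indicE !mem_set.
Qed.

End discrete_measure.

(** * The majorizing measure obtained from a bounded tree functional *)

Section construction.
Variables (R : realType) (a : nat -> R) (l B : R).
Hypothesis a_gt0 : forall n, 0 < a n.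
Hypothesis psum_lt : forall n, psum a n < l.
Hypothesis psum_sup : forall y, y < l -> exists n, y < psum a n.
Local Notation T := (partial_squares a).

Let x n := psum a n / l.
Let l0 : 0 < l. Proof. by rewrite -(psum0 a). Qed.
Let x0 n : 0 <= x n. Proof. exact: x_ge0. Qed.
Let x1 n : x n < 1. Proof. exact: x_lt1. Qed.

Hypothesis VB : forall d, treeV x d 0 0 <= B.

Let wt := atom x.
Let tm := tmass x.
Let wt_ge0 n : 0 <= wt n. Proof. exact: (atom_ge0 x0 x1 VB). Qed.

(* A point of the last cell of level k, which contains infinitely many points
   and whose mass may escape to the limit point. *)
Let lp k : nat := sval (cid (cell_last psum_lt psum_sup k)).

Let lpP k : cell x k (lp k) = last_index k /\ forall n, (lp k <= n)%N -> cell x k n = last_index k.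
Proof. exact: (svalP (cid (cell_last psum_lt psum_sup k))). Qed.

(** A ratio strictly between 1/4 and 1 makes both [c k] and [2^-1 ^+ k / sqrt (c k) = (3/4) ^+ k]
    summable: the total mass stays finite, and so does the cost of the last cells in the
    integral. *)
Let c k : R := (4/9) ^+ k.
Let c_ge0 k : 0 <= c k. Proof. by rewrite exprn_ge0. Qed.

Let mu1 := discrete_measure (psum a) wt_ge0.
Let mu2 := discrete_measure (fun k => psum a (lp k)) c_ge0.
Let mu : {measure set (measurableTypeR R) -> \bar R} := measure_add mu1 mu2.

Let muE A : mu A = (mu1 A + mu2 A)%E. Proof. exact: measure_addE. Qed.

Let mu_le3 : (mu setT <= 3%:E)%E.
Proof.
rewrite muE; apply: (@le_trans _ _ (1%:E + 2%:E)%E); last by rewrite -EFinD lee_fin; lra.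
apply: leeD; apply: discrete_measure_le => N.
  apply: (sum_atom_le x0 x1 VB); have [L hL] := cells_separated a_gt0 psum_lt N.
  by exists L => n m nN mN; apply: (hL L) => //; exact: ltnW.
suff : \sum_(n < N) c n + 9/5 * (4/9) ^+ N = 9/5.
  have : 0 <= 9/5 * (4/9) ^+ N :> R by rewrite mulr_ge0 ?exprn_ge0.
  lra.
elim: N => [|N IH]; first by rewrite big_ord0 expr0; ring.
apply: etrans IH; rewrite big_ord_recr/= exprS /c.
by move: (\sum_(i < N) _) ((4/9) ^+ N) => s e; field.
Qed.

Let mu_ge1 : (1%:E <= mu setT)%E.
Proof.
rewrite muE; have := discrete_measure_ge (fun k => psum a (lp k)) c_ge0 1 setT.
rewrite big_ord1 indicT mulr1 /c expr0 => h; apply: le_trans h _.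
by rewrite leeDr// measure_ge0.
Qed.

Let m : probability (measurableTypeR R) R := mnormalize mu (@dirac _ (measurableTypeR R) 0 R).

Let mE A : m A = (mu A * ((fine (mu setT))^-1)%:E)%E.
Proof.
rewrite /m /= /mnormalize; case: ifP => // /orP[/eqP e|/eqP e].
  by move: mu_ge1; rewrite e lee_fin ler10.
by move: mu_le3; rewrite e leye_eq.
Qed.

Let mu_fin : mu setT \is a fin_num.
Proof.
by rewrite ge0_fin_numE ?measure_ge0//; apply: le_lt_trans mu_le3 _; rewrite ltry.
Qed.

Let mT : m T = 1%E.
Proof.
have -> : m T = (mu setT * ((fine (mu setT))^-1)%:E)%E.
  rewrite mE !muE; congr ((_ + _) * _)%E; apply: discrete_measure_full => n.
    by rewrite partial_squaresE; exists n.
  by rewrite partial_squaresE; exists (lp n).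
have f1 : 1 <= fine (mu setT) by rewrite -lee_fin fineK.
by rewrite -{1}(fineK mu_fin) -EFinM divff// gt_eqF// (lt_le_trans ltr01).
Qed.

Let m_ge A y : 0 <= y -> (y%:E <= mu A)%E -> ((y / 3)%:E <= m A)%E.
Proof.
move=> y0 yA; rewrite mE EFinM; apply: lee_pmul; rewrite ?lee_fin ?invr_ge0//.
have f1 : 1 <= fine (mu setT) by rewrite -lee_fin fineK.
have f3 : fine (mu setT) <= 3 by rewrite -lee_fin fineK.
by rewrite lef_pV2 ?posrE// (lt_le_trans ltr01).
Qed.

Let cell_ball k n p : cell x k p = cell x k n ->
  cball_in T (psum a n) (l * (2^-1 ^+ k) ^+ 2) (psum a p).
Proof.
move=> e; rewrite /cball_in partial_squaresE; split; first by exists p.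
exact: cell_dist.
Qed.

(** The ball contains the cell of [x n]. A last cell has mass at least [c k] because of the point
    [lp k], and [(sqrt (c k))^-1 = (3/2) ^+ k]. Any other cell contains finitely many points, so its
    atoms account for all of its mass [tm]. *)
Let ball_mass k n : exists2 y, 0 < y & (((Num.sqrt y)^-1 <= (Num.sqrt (tm k (cell x k n)))^-1 + (3/2) ^+ k) /\
  (y%:E <= mu (cball_in T (psum a n) (l * (2^-1 ^+ k) ^+ 2)))%E).
Proof.
have t0 : 0 < tm k (cell x k n) by exact: (tmass_gt0 x0 x1 VB).
have [e|ne] := eqVneq (cell x k n) (last_index k).
  exists (c k); first by rewrite exprn_gt0.
  split.
    have -> : c k = ((2/3) ^+ k) ^+ 2 by rewrite exprAC; congr (_ ^+ _); field.
    rewrite sqrtr_sqr ger0_norm ?exprn_ge0// -exprVn invf_div lerDr invr_ge0 sqrtr_ge0//.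
  rewrite muE; have h := discrete_measure_ge (fun k => psum a (lp k)) c_ge0 k.+1
    (cball_in T (psum a n) (l * (2^-1 ^+ k) ^+ 2)).
  apply: (@le_trans _ _ (mu2 (cball_in T (psum a n) (l * (2^-1 ^+ k) ^+ 2)))); last first.
    by rewrite leeDr// measure_ge0.
  apply: le_trans h; rewrite lee_fin big_ord_recr/= indicE mem_set; last first.
    by apply: cell_ball; rewrite e; have [] := lpP k.
  by rewrite mulr1 lerDr sumr_ge0// => j _; rewrite mulr_ge0.
exists (tm k (cell x k n)) => //; split; first by rewrite lerDl exprn_ge0.
rewrite muE; have h := discrete_measure_ge (psum a) wt_ge0 (lp k)
    (cball_in T (psum a n) (l * (2^-1 ^+ k) ^+ 2)).
apply: (@le_trans _ _ (mu1 (cball_in T (psum a n) (l * (2^-1 ^+ k) ^+ 2)))); last first.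
  by rewrite leeDl// measure_ge0.
apply: le_trans h; rewrite lee_fin.
have fin p : cell x k p = cell x k n -> (p < lp k)%N.
  move=> pn; rewrite ltnNge; apply/negP => lpp; move/eqP: ne; apply.
  by rewrite -pn; have [_] := lpP k; apply.
apply: le_trans (sum_atom_ge x0 x1 VB fin) _.
rewrite big_mkcond/=; apply: ler_sum => p _; case: eqP => [pn|_]; last by rewrite mulr_ge0.
by rewrite indicE mem_set ?mulr1//; exact: cell_ball.
Qed.

Lemma treeV_majorizing : exists m, majorizing_measure T m.
Proof.
exists m; split; first exact: mT.
(* The factor 2 exceeds the root of the 3 lost in the normalisation, [Vlim x 0 0] bounds the
   telescoped path sum, and 4 bounds the geometric sum of the [(3/4) ^+ k.+1], which is at most
   3. *)
pose K : R := Num.sqrt l * (2 * (Vlim x 0 0 + 4)).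
apply: (@le_lt_trans _ _ K%:E); last exact: ltry.
apply: ge_ereal_sup => _ [t tT <-].
have [n _ <-] : range (psum a) t by rewrite -partial_squaresE.
rewrite (integral_domainE psum_lt psum_sup).
have sl0 : 0 < Num.sqrt l by rewrite sqrtr_gt0.
apply: integral_le_dyadic => //.
- by move=> r; exact: integrand_ge0.
- by move=> r s r0 rs _; exact: integrand_ni.
move=> d; apply: (@le_trans _ _ (\sum_(k < d) (Num.sqrt l * (2^-1 ^+ k.+1 *
    (2 * ((Num.sqrt (tm k.+1 (cell x k.+1 n)))^-1 + (3/2) ^+ k.+1))))%:E)%E).
  apply: lee_sum => k _; rewrite [leRHS](_ : _ = (Num.sqrt l * 2^-1 ^+ k.+1)%:E *
    (2 * ((Num.sqrt (tm k.+1 (cell x k.+1 n)))^-1 + (3/2) ^+ k.+1))%:E)%E; last first.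
    by rewrite -EFinM; congr (_%:E); ring.
  apply: lee_wpmul2l.
    by rewrite lee_fin mulr_ge0 ?exprn_ge0// ltW.
  rewrite /integrand exprMn sqr_sqrtr ?(ltW l0)//.
  have [y y0 [y1 y2]] := ball_mass k.+1 n.
  have y3 := m_ge (ltW y0) y2.
  apply: (@le_trans _ _ ((Num.sqrt (y / 3))^-1)%:E); last first.
    rewrite lee_fin; apply: (@le_trans _ _ (2 * (Num.sqrt y)^-1)); last by rewrite ler_pM2l.
    rewrite sqrtrM ?(ltW y0)// invfM mulrC ler_wpM2r ?invr_ge0 ?sqrtr_ge0//.
    rewrite sqrtrV// invrK -[leRHS]ger0_norm// -sqrtr_sqr ler_wsqrtr//; lra.
  have -> : ((Num.sqrt (y / 3))^-1)%:E = ((sqrte (y / 3)%:E)^-1)%E.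
    by rewrite /= inver gt_eqF// sqrtr_gt0 divr_gt0.
  by rewrite lee_pV2 ?inE ?sqrte_ge0// lee_sqrt// measure_ge0.
rewrite sumEFin lee_fin -mulr_sumr ler_pM2l//.
have -> : \sum_(k < d) 2^-1 ^+ k.+1 * (2 * ((Num.sqrt (tm k.+1 (cell x k.+1 n)))^-1 + (3/2) ^+ k.+1)) =
    2 * (\sum_(k < d) 2^-1 ^+ k.+1 / Num.sqrt (tm k.+1 (cell x k.+1 n)) + \sum_(k < d) (3/4) ^+ k.+1).
  rewrite -big_split mulr_sumr; apply: eq_bigr => k _.
  have -> : (3/4) ^+ k.+1 = 2^-1 ^+ k.+1 * (3/2) ^+ k.+1 :> R by rewrite -exprMn; congr (_ ^+ _); field.
  by rewrite /=; ring.
rewrite ler_pM2l//; apply: lerD.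
  have := tmass_telescope x0 x1 VB n d.+1; rewrite big_ord_recl/= => h.
  apply: le_trans h; rewrite -addrA [leRHS]addrCA lerDl; apply: addr_ge0.
    by rewrite divr_ge0 ?sqrtr_ge0 ?exprn_ge0.
  by rewrite divr_ge0 ?sqrtr_ge0//; exact: Vlim_ge0 x1 VB _ _.
suff : \sum_(k < d) (3/4) ^+ k.+1 + 4 * (3/4) ^+ d.+1 = 3 :> R.
  have : 0 <= 4 * (3/4) ^+ d.+1 :> R by rewrite mulr_ge0 ?exprn_ge0.
  lra.
elim: (d) => [|e IH]; first by rewrite big_ord0 expr1; field.
apply: etrans IH; rewrite big_ord_recr/= [(3/4) ^+ e.+2]exprS.
by move: (\sum_(i < e) _) ((3/4) ^+ e.+1) => s r; field.
Qed.

End construction.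

Unset Implicit Arguments.

Theorem corollary1 (R : realType) (a : R^nat) (a_gt0 : forall n, 0 < a n) :
  (forall (d : measure_display) (Omega : measurableType d)
          (P : probability Omega R) (phi : nat -> {RV P >-> R}),
      orthonormal_sequence phi ->
      {ae P, forall w, cvgn (series (fun n => a n * phi n w))})
  <->
  (exists m : probability (measurableTypeR R) R,
      majorizing_measure (partial_squares a) m).
Proof.
split=> [conv|[m mm]].
  have [K hK] := frames_bounded a_gt0 conv.
  have pK n : psum a n <= K by have [s fs <-] := trivial_frame a n; exact: hK fs.
  have [l [lt_l sup_l]] := psum_limit a_gt0 pK.
  have [B hB] := treeV_frame_bounded lt_l hK.
  exact: treeV_majorizing a_gt0 lt_l sup_l hB.
have [K pK] := majorizing_bounded mm.
have [l [lt_l sup_l]] := psum_limit a_gt0 pK.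
have [B hB] := majorizing_treeV lt_l sup_l a_gt0 mm.
exact (treeV_ae_convergent a_gt0 lt_l sup_l hB).
Qed.
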